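(* Let $\mathcal{S}=(\sigma_{ij})\in\mathrm{SL}(2,\mathbb{Z})$ with $\mathrm{tr}(\mathcal{S})>2$ and $\Gamma_{\mathcal{S}}=\mathbb{Z}^2\rtimes_{\mathcal{S}}\mathbb{Z}$. (1) There is a one-one correspondence between the equivalence classes of central extensions $1\to\mathbb{Z}\to\tilde\Gamma\to\Gamma_{\mathcal{S}}\to1$ and the set $\mathbb{Z}\oplus\mathrm{Coker}(\mathcal{S}-I)$, where $\mathrm{Coker}(\mathcal{S}-I)=\mathbb{Z}^2/(\mathcal{S}-I)\mathbb{Z}^2$. (2) For each $\{q,(m_1,m_2)\}\in\mathbb{Z}\oplus\mathrm{Coker}(\mathcal{S}-I)$ with $q\neq0$, the corresponding extension is the group $$\tilde\Gamma_{(\mathcal{S};q,m_1,m_2)}=\langle \mathbf{t}_1,\mathbf{t}_2,\mathbf{t}_3,\tau\mid [\mathbf{t}_1,\mathbf{t}_2]=\tau^q,\ \tau\text{ central},\ \mathbf{t}_3\mathbf{t}_1\mathbf{t}_3^{-1}=\mathbf{t}_1^{\sigma_{11}}\mathbf{t}_2^{\sigma_{21}}\tau^{m_1},\ \mathbf{t}_3\mathbf{t}_2\mathbf{t}_3^{-1}=\mathbf{t}_1^{\sigma_{12}}\mathbf{t}_2^{\sigma_{22}}\tau^{m_2}\rangle$$ (with central $\mathbb{Z}=\langle\tau\rangle$), which is solvable and contains $\Gamma_q=\langle\mathbf{t}_1,\mathbf{t}_2,\tau\rangle$ as its discrete nilradical; and each of these groups embeds into $\mathrm{Sol}_1^4$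 as a lattice.
   Context: $\mathbb{Z}^2\rtimes_{\mathcal{S}}\mathbb{Z}$ is the group on $\mathbb{Z}^2\times\mathbb{Z}$ with $(\mathbf{x},m)(\mathbf{y},n)=(\mathbf{x}+\mathcal{S}^m\mathbf{y},m+n)$. $\mathrm{Sol}_1^4$ is the group of real matrices $\begin{pmatrix}1&x&z\\0&e^u&y\\0&0&1\end{pmatrix}$; a lattice is a discrete cocompact subgroup. (In the paper $\tau$ is written $\mathbf{t}_4^{1/q}$ with $\mathbf{t}_4=[\mathbf{t}_1,\mathbf{t}_2]$.)
   Formalization: Coker(S−I) is taken as Z² modulo the row image {(a,b)(S−I)}, i.e. (Sᵀ−I)Z², instead of the column image (S−I)Z²; only with rows does the class of (m₁,m₂) determine the extension (columns fail e.g. for S=[[1,1],[2,3]]). *)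

(* Defs.v *)
From Stdlib Require Import ZArith Reals Lra Lia.
Open Scope Z_scope.

Record Grp := {
  gcar :> Type;
  gop : gcar -> gcar -> gcar;
  gid : gcar;
  ginv : gcar -> gcar;
  gassoc : forall x y z, gop x (gop y z) = gop (gop x y) z;
  gid_l : forall x, gop gid x = x;
  ginv_l : forall x, gop (ginv x) x = gid }.

Arguments gop {g} _ _.
Arguments gid {g}.
Arguments ginv {g} _.

Fixpoint gpow_nat {G : Grp} (x : G) (n : nat) : G :=
  match n with O => gid | S k => gop x (gpow_nat x k) end.

Definition gpow {G : Grp} (x : G) (n : Z) : G :=
  match n with
  | Z0 => gid
  | Zpos p => gpow_nat x (Pos.to_nat p)
  | Zneg p => ginv (gpow_nat x (Pos.to_nat p))
  end.

Definition gcomm {G : Grp} (x y : G) : G :=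
  gop (gop (gop x y) (ginv x)) (ginv y).

Definition is_hom {G H : Grp} (f : G -> H) : Prop :=
  forall x y, f (gop x y) = gop (f x) (f y).

Definition is_subgroup {G : Grp} (K : G -> Prop) : Prop :=
  K gid /\ (forall x y, K x -> K y -> K (gop x y)) /\ (forall x, K x -> K (ginv x)).

Definition gen {G : Grp} (A : G -> Prop) : G -> Prop :=
  fun x => forall K : G -> Prop, is_subgroup K -> (forall y, A y -> K y) -> K x.

Definition commsub {G : Grp} (K L : G -> Prop) : G -> Prop :=
  gen (fun z => exists k l, K k /\ L l /\ z = gcomm k l).

Definition is_normal {G : Grp} (N : G -> Prop) : Prop :=
  is_subgroup N /\ forall g x, N x -> N (gop (gop g x) (ginv g)).

Fixpoint derived (G : Grp) (n : nat) : G -> Prop :=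
  match n with
  | O => fun _ => True
  | S k => commsub (derived G k) (derived G k)
  end.

Definition solvable (G : Grp) : Prop :=
  exists n, forall x, derived G n x -> x = gid.

Fixpoint lcs {G : Grp} (N : G -> Prop) (n : nat) : G -> Prop :=
  match n with
  | O => N
  | S k => commsub N (lcs N k)
  end.

Definition nilpotent_sub {G : Grp} (N : G -> Prop) : Prop :=
  exists n, forall x, lcs N n x -> x = gid.

Definition is_nilradical {G : Grp} (N : G -> Prop) : Prop :=
  is_normal N /\ nilpotent_sub N /\
  forall M : G -> Prop, is_normal M -> nilpotent_sub M -> forall x, M x -> N x.

Record M2 := mkM2 { m11 : Z; m12 : Z; m21 : Z; m22 : Z }.

Definition M2mul (A B : M2) : M2 :=
  mkM2 (m11 A * m11 B + m12 A * m21 B) (m11 A * m12 B + m12 A * m22 B)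
       (m21 A * m11 B + m22 A * m21 B) (m21 A * m12 B + m22 A * m22 B).

Definition M2id : M2 := mkM2 1 0 0 1.

(** inverse of a determinant-one matrix *)
Definition M2inv1 (A : M2) : M2 := mkM2 (m22 A) (- m12 A) (- m21 A) (m11 A).

Fixpoint M2pow_nat (A : M2) (n : nat) : M2 :=
  match n with O => M2id | S k => M2mul A (M2pow_nat A k) end.

Definition M2pow (A : M2) (m : Z) : M2 :=
  match m with
  | Z0 => M2id
  | Zpos p => M2pow_nat A (Pos.to_nat p)
  | Zneg p => M2pow_nat (M2inv1 A) (Pos.to_nat p)
  end.

Definition M2app (A : M2) (v : Z * Z) : Z * Z :=
  (m11 A * fst v + m12 A * snd v, m21 A * fst v + m22 A * snd v).

Definition GammaS_mul (S : M2) (a b : (Z * Z) * Z) : (Z * Z) * Z :=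
  let (x, m) := a in let (y, n) := b in
  let w := M2app (M2pow S m) y in
  ((fst x + fst w, snd x + snd w), m + n).

Definition GammaS_id : (Z * Z) * Z := ((0, 0), 0).

Definition is_central_ext (S : M2) (G : Grp) (iota : Z -> G)
  (pi : G -> (Z * Z) * Z) : Prop :=
  (forall a b, iota (a + b) = gop (iota a) (iota b)) /\
  (forall a b, iota a = iota b -> a = b) /\
  (forall n g, gop (iota n) g = gop g (iota n)) /\
  (forall g h, pi (gop g h) = GammaS_mul S (pi g) (pi h)) /\
  (forall c, exists g, pi g = c) /\
  (forall g, pi g = GammaS_id <-> exists n, g = iota n).

Record CExt (S : M2) := mkCExt {
  cx_grp : Grp;
  cx_iota : Z -> cx_grp;
  cx_pi : cx_grp -> (Z * Z) * Z;
  cx_ok : is_central_ext S cx_grp cx_iota cx_pi }.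

Arguments cx_grp {S} _.
Arguments cx_iota {S} _ _.
Arguments cx_pi {S} _ _.

(** equivalence of extensions: a homomorphism commuting with iota and pi
    (it is then automatically an isomorphism) *)
Definition ext_equiv {S : M2} (E1 E2 : CExt S) : Prop :=
  exists phi : cx_grp E1 -> cx_grp E2,
    is_hom phi /\ (forall n, phi (cx_iota E1 n) = cx_iota E2 n) /\
    (forall g, cx_pi E2 (phi g) = cx_pi E1 g).

(** equality in Coker(S - I) = Z^2 / Z^2 (S - I), Z^2 written as ROW vectors
    (a,b) |-> (a,b)(S - I); this is the convention in which the pair (m1,m2) of
    the presentation below is a well-defined class *)
Definition coker_eq (S : M2) (v w : Z * Z) : Prop :=
  exists a b : Z,
    fst v - fst w = (m11 S - 1) * a + m21 S * b /\
    snd v - snd w = m12 S * a + (m22 S - 1) * b.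

Definition pres_rel (S : M2) (q m1 m2 : Z) {H : Grp} (t1 t2 t3 tau : H) : Prop :=
  gcomm t1 t2 = gpow tau q /\
  gop tau t1 = gop t1 tau /\ gop tau t2 = gop t2 tau /\ gop tau t3 = gop t3 tau /\
  gop (gop t3 t1) (ginv t3) =
    gop (gop (gpow t1 (m11 S)) (gpow t2 (m21 S))) (gpow tau m1) /\
  gop (gop t3 t2) (ginv t3) =
    gop (gop (gpow t1 (m12 S)) (gpow t2 (m22 S))) (gpow tau m2).

Definition is_presented (S : M2) (q m1 m2 : Z) (P : Grp) (t1 t2 t3 tau : P) : Prop :=
  pres_rel S q m1 m2 t1 t2 t3 tau /\
  forall (H : Grp) (a1 a2 a3 b : H), pres_rel S q m1 m2 a1 a2 a3 b ->
    (exists f : P -> H, is_hom f /\ f t1 = a1 /\ f t2 = a2 /\ f t3 = a3 /\ f tau = b) /\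
    (forall f g : P -> H, is_hom f -> is_hom g ->
       f t1 = g t1 -> f t2 = g t2 -> f t3 = g t3 -> f tau = g tau ->
       forall x, f x = g x).

Open Scope R_scope.

Definition M3 := nat -> nat -> R.

Definition mmul3 (A B : M3) : M3 :=
  fun i j => A i 0%nat * B 0%nat j + A i 1%nat * B 1%nat j + A i 2%nat * B 2%nat j.

Definition R4 := (R * R * R * R)%type.

Definition sol_mx (c : R4) : M3 :=
  let '(x, y, z, u) := c in
  fun i j =>
    match i, j with
    | 0%nat, 0%nat => 1
    | 0%nat, 1%nat => x
    | 0%nat, 2%nat => z
    | 1%nat, 1%nat => exp u
    | 1%nat, 2%nat => y
    | 2%nat, 2%nat => 1
    | _, _ => 0
    end.

Definition mx3_eq (A B : M3) : Prop :=
  forall i j, (i < 3)%nat -> (j < 3)%nat -> A i j = B i j.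

Definition R4_bounded (B : R) (c : R4) : Prop :=
  let '(x, y, z, u) := c in
  Rabs x <= B /\ Rabs y <= B /\ Rabs z <= B /\ Rabs u <= B.

Definition R4_small (eps : R) (c : R4) : Prop :=
  let '(x, y, z, u) := c in
  Rabs x < eps /\ Rabs y < eps /\ Rabs z < eps /\ Rabs u < eps.

(** rho : P -> Sol_1^4 (via coordinates) is an injective homomorphism whose
    image is a lattice: discrete (a neighbourhood of the identity meets the image
    only in the identity) and cocompact (Sol = image * K for a compact K; every
    compact set lies in a coordinate box and boxes are compact). *)
Definition sol_lattice_embedding (P : Grp) (rho : P -> R4) : Prop :=
  (forall g h, rho g = rho h -> g = h) /\
  (forall g h, mx3_eq (sol_mx (rho (gop g h))) (mmul3 (sol_mx (rho g)) (sol_mx (rho h)))) /\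
  (exists eps, 0 < eps /\ forall g, R4_small eps (rho g) -> g = gid) /\
  (exists B, forall c : R4, exists (g : P) (k : R4),
      R4_bounded B k /\ mx3_eq (sol_mx c) (mmul3 (sol_mx (rho g)) (sol_mx k))).

Close Scope R_scope.

(* Main.v *)
Require Import Defs.
From Stdlib Require Import ZArith Reals Lra Lia FinFun IndefiniteDescription.
Open Scope Z_scope.

(** Lifting the generators of [Z^2 x| Z] to [t1, t2, t3] in a central extension, the
    commutator of [t1, t2] and the two conjugation relations define integers [q, m1, m2].
    Multiplying the lifts by central elements fixes [q] and moves [(m1, m2)] by the row
    image of [S - I], so the class of [(q, (m1, m2))] is an invariant.  The presented group
    is [H_q x| Z], where [H_q] is the Heisenberg group with [t1 t2 = t2 t1 tau^q] and [Z]
    acts through the automorphism prescribed by [m1, m2]; it is a central extension, and by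
    the five lemma its universal property makes it equivalent to every extension with the
    same invariants.

    Real left eigenvectors [x, y] of [S], for eigenvalues [exp (-u)] and [exp u], serve twice.
    The linear forms they define are jointly injective on [Z^2] and scaled by [S], so no power
    [S^n] with [n <> 0] fixes a nonzero vector; hence an element outside [H_q] is not a left
    Engel element and lies in no normal nilpotent subgroup.  For [q <> 0], [x] and [y] are the
    off-diagonal entries of [t1, t2] in [Sol_1^4]; the corner entries are then forced by a
    linear system that is solvable because [det (S - I) = 2 - tr S] does not vanish. *)

Local Infix "⋅" := gop (at level 40, left associativity).
Local Notation "x ⁻¹" := (ginv x) (at level 1, format "x ⁻¹").

(** * Integer iterates of a bijection *)

Ltac Z_induction n :=
  pattern n; apply Z.bi_induction; clear n;
  [now intros ? ? -> | | intros n; rewrite <- Z.add_1_r]; cbv beta.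

Lemma Z_nat_cases (n : Z) :
  (exists k : nat, n = Z.of_nat k) \/ (exists k : nat, n = - Z.of_nat (S k)).
Proof.
  destruct (Z_le_dec 0 n).
  - left. exists (Z.to_nat n). lia.
  - right. exists (Z.to_nat (- n - 1)). lia.
Qed.

Definition ziter {T : Type} (f g : T -> T) (n : Z) (x : T) : T :=
  match n with
  | Z0 => x
  | Zpos p => Nat.iter (Pos.to_nat p) f x
  | Zneg p => Nat.iter (Pos.to_nat p) g x
  end.

Lemma ziter_of_nat {T : Type} (f g : T -> T) (k : nat) (x : T) :
  ziter f g (Z.of_nat k) x = Nat.iter k f x.
Proof. destruct k; simpl; [easy|]. now rewrite SuccNat2Pos.id_succ. Qed.

Lemma ziter_opp_of_nat {T : Type} (f g : T -> T) (k : nat) (x : T) :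
  ziter f g (- Z.of_nat k) x = Nat.iter k g x.
Proof. destruct k; simpl; [easy|]. now rewrite SuccNat2Pos.id_succ. Qed.

Lemma ziter_semiconj {T U : Type} (h : T -> U) (f g : T -> T) (f' g' : U -> U)
  (n : Z) (x : T) :
  (forall y, h (f y) = f' (h y)) -> (forall y, h (g y) = g' (h y)) ->
  h (ziter f g n x) = ziter f' g' n (h x).
Proof. intros hf hg. destruct n; simpl; [easy| |]; now apply Nat.iter_swap_gen. Qed.

Lemma ziter_succ {T : Type} (f g : T -> T) (n : Z) (x : T) :
  (forall y, f (g y) = y) -> ziter f g (n + 1) x = f (ziter f g n x).
Proof.
  intros fg. destruct (Z_nat_cases n) as [[k ->]|[k ->]].
  - replace (Z.of_nat k + 1) with (Z.of_nat (S k)) by lia.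
    now rewrite !ziter_of_nat.
  - replace (- Z.of_nat (S k) + 1) with (- Z.of_nat k) by lia.
    now rewrite !ziter_opp_of_nat, Nat.iter_succ, fg.
Qed.

Lemma ziter_add {T : Type} (f g : T -> T) (m n : Z) (x : T) :
  (forall y, f (g y) = y) -> (forall y, g (f y) = y) ->
  ziter f g (m + n) x = ziter f g m (ziter f g n x).
Proof.
  intros fg gf. Z_induction m; [easy|].
  replace (m + 1 + n) with (m + n + 1) by ring.
  rewrite !ziter_succ by easy. split; intros E; [now rewrite E|].
  rewrite <- (gf (ziter f g (m + n) x)), E. apply gf.
Qed.

Lemma ziter_hom {N : Grp} (f g : N -> N) (n : Z) :
  is_hom f -> (forall y, f (g y) = y) -> (forall y, g (f y) = y) ->
  is_hom (ziter f g n).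
Proof.
  intros f_hom fg gf. assert (g_hom : is_hom g).
  { intros x y. rewrite <- (fg x), <- (fg y) at 1. now rewrite <- f_hom, !gf. }
  Z_induction n; [easy|].
  enough (E : forall x, ziter f g n x = g (ziter f g (n + 1) x)).
  { split; intros n_hom x y.
    - now rewrite !ziter_succ, n_hom, f_hom.
    - now rewrite !E, n_hom, g_hom. }
  intros x. now rewrite ziter_succ, gf.
Qed.

(** * Groups *)

Lemma gcancel_l {G : Grp} (x y z : G) : x ⋅ y = x ⋅ z -> y = z.
Proof.
  intros E. rewrite <- (gid_l _ y), <- (gid_l _ z), <- (ginv_l _ x), <- !gassoc.
  now rewrite E.
Qed.

Lemma ginv_r {G : Grp} (x : G) : x ⋅ x⁻¹ = gid.
Proof.
  apply (gcancel_l x⁻¹). rewrite gassoc, ginv_l, gid_l.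
  apply (gcancel_l x⁻¹⁻¹). now rewrite gassoc, ginv_l, gid_l.
Qed.

Lemma gid_r {G : Grp} (x : G) : x ⋅ gid = x.
Proof. now rewrite <- (ginv_l _ x), gassoc, ginv_r, gid_l. Qed.

Lemma gcancel_r {G : Grp} (x y z : G) : y ⋅ x = z ⋅ x -> y = z.
Proof.
  intros E. rewrite <- (gid_r y), <- (gid_r z), <- (ginv_r x), !gassoc.
  now rewrite E.
Qed.

Lemma gopK {G : Grp} (x y : G) : x ⋅ y ⋅ y⁻¹ = x.
Proof. now rewrite <- gassoc, ginv_r, gid_r. Qed.

Lemma gopVK {G : Grp} (x y : G) : x ⋅ y⁻¹ ⋅ y = x.
Proof. now rewrite <- gassoc, ginv_l, gid_r. Qed.

Lemma ginv_unique {G : Grp} (x y : G) : x ⋅ y = gid -> x = y⁻¹.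
Proof. intros E. apply (gcancel_r y). now rewrite E, ginv_l. Qed.

Lemma ginv_op {G : Grp} (x y : G) : (x ⋅ y)⁻¹ = y⁻¹ ⋅ x⁻¹.
Proof. symmetry. apply ginv_unique. now rewrite gassoc, gopVK, ginv_l. Qed.

Lemma ginv_inv {G : Grp} (x : G) : x⁻¹⁻¹ = x.
Proof. symmetry. apply ginv_unique, ginv_r. Qed.

Lemma ginv_id {G : Grp} : (@gid G)⁻¹ = gid.
Proof. symmetry. apply ginv_unique, gid_l. Qed.

Lemma gidem_id {G : Grp} (x : G) : x ⋅ x = x -> x = gid.
Proof. intros E. apply (gcancel_l x). now rewrite E, gid_r. Qed.

Lemma conj_eq {G : Grp} (x y w : G) : x ⋅ y ⋅ x⁻¹ = w <-> x ⋅ y = w ⋅ x.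
Proof. split; intros E; [now rewrite <- E, gopVK|now rewrite E, gopK]. Qed.

Lemma conj_hom {G : Grp} (x : G) : is_hom (fun y => x ⋅ y ⋅ x⁻¹).
Proof. intros y z. now rewrite !gassoc, gopVK. Qed.

Lemma hom_id {G H : Grp} (f : G -> H) : is_hom f -> f gid = gid.
Proof. intros f_hom. apply gidem_id. now rewrite <- f_hom, gid_l. Qed.

Lemma hom_inv {G H : Grp} (f : G -> H) (x : G) : is_hom f -> f x⁻¹ = (f x)⁻¹.
Proof. intros f_hom. apply ginv_unique. rewrite <- f_hom, ginv_l. now apply hom_id. Qed.

Lemma hom_injective {G H : Grp} (f : G -> H) :
  is_hom f -> (forall x, f x = gid -> x = gid) -> Injective f.
Proof.
  intros f_hom ker x y E. apply (gcancel_r y⁻¹). rewrite ginv_r.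
  apply ker. now rewrite f_hom, hom_inv, E, ginv_r.
Qed.

Definition inverse_homs {G H : Grp} (f : G -> H) (g : H -> G) : Prop :=
  is_hom f /\ is_hom g /\ (forall x, g (f x) = x) /\ (forall y, f (g y) = y).

Lemma inverse_homs_of_bijection {G H : Grp} (f : G -> H) :
  is_hom f -> Injective f -> Surjective f -> exists g, inverse_homs f g.
Proof.
  intros f_hom f_inj f_surj. destruct (functional_choice _ f_surj) as [g fg].
  exists g. repeat split; auto.
  intros x y. apply f_inj. now rewrite f_hom, !fg.
Qed.

(** * Integer powers and commuting elements *)

Lemma gpow_nat_r {G : Grp} (x : G) (k : nat) : gpow_nat x k ⋅ x = x ⋅ gpow_nat x k.
Proof.
  induction k as [|k IH]; simpl; [now rewrite gid_l, gid_r|].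
  now rewrite <- gassoc, IH.
Qed.

Lemma gpow_ziter {G : Grp} (x : G) (n : Z) :
  gpow x n = ziter (gop x) (gop x⁻¹) n gid.
Proof.
  destruct n as [|p|p]; simpl; [easy| |]; generalize (Pos.to_nat p); intros k;
    induction k as [|k IH]; simpl; [easy|now rewrite IH|apply ginv_id|].
  now rewrite <- gpow_nat_r, ginv_op, IH.
Qed.

Lemma gpow_succ {G : Grp} (x : G) (n : Z) : gpow x (n + 1) = x ⋅ gpow x n.
Proof.
  rewrite !gpow_ziter. apply ziter_succ. intros y. now rewrite gassoc, ginv_r, gid_l.
Qed.

Lemma gpow_add {G : Grp} (x : G) (m n : Z) : gpow x (m + n) = gpow x m ⋅ gpow x n.
Proof.
  Z_induction m; [now rewrite gid_l|].
  replace (m + 1 + n) with (m + n + 1) by ring.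
  rewrite !gpow_succ, <- gassoc. split; intros E; [now rewrite E|].
  now apply gcancel_l in E.
Qed.

Lemma gpow_0 {G : Grp} (x : G) : gpow x 0 = gid.
Proof. reflexivity. Qed.

Lemma gpow_1 {G : Grp} (x : G) : gpow x 1 = x.
Proof. apply gid_r. Qed.

Lemma gpow_unique {G : Grp} (h : Z -> G) (n : Z) :
  (forall a b, h (a + b) = h a ⋅ h b) -> h n = gpow (h 1) n.
Proof.
  intros h_add. assert (h0 : h 0 = gid) by (apply gidem_id; now rewrite <- h_add).
  Z_induction n; [easy|].
  rewrite gpow_succ, Z.add_comm, h_add. split; intros E; [now rewrite E|].
  now apply gcancel_l in E.
Qed.

Lemma hom_gpow {G H : Grp} (f : G -> H) (x : G) (n : Z) :
  is_hom f -> f (gpow x n) = gpow (f x) n.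
Proof.
  intros f_hom. rewrite (gpow_unique (fun n => f (gpow x n))).
  - now rewrite gpow_1.
  - intros a b. now rewrite gpow_add, f_hom.
Qed.

Lemma gpow_gpow {G : Grp} (x : G) (m n : Z) : gpow (gpow x m) n = gpow x (m * n).
Proof.
  rewrite (gpow_unique (fun n => gpow x (m * n))).
  - now rewrite Z.mul_1_r.
  - intros a b. now rewrite Z.mul_add_distr_l, gpow_add.
Qed.

Lemma gpow_m1 {G : Grp} (x : G) : gpow x (-1) = x⁻¹.
Proof. simpl. now rewrite gid_r. Qed.

Lemma subgroup_gpow {G : Grp} (K : G -> Prop) (x : G) (n : Z) :
  is_subgroup K -> K x -> K (gpow x n).
Proof.
  intros (K_id & K_op & K_inv) Kx.
  assert (K_nat : forall k, K (gpow_nat x k)) by (induction k; simpl; auto).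
  destruct n; simpl; auto.
Qed.

Lemma gen_subgroup {G : Grp} (A : G -> Prop) : is_subgroup (gen A).
Proof.
  repeat split.
  - now intros K (K_id & _) _.
  - intros x y Ax Ay K K_sub AK. apply K_sub; [apply Ax|apply Ay]; auto.
  - intros x Ax K K_sub AK. apply K_sub, Ax; auto.
Qed.

Lemma kernel_subgroup {G H : Grp} (f : G -> H) :
  is_hom f -> is_subgroup (fun x => f x = gid).
Proof.
  intros f_hom. repeat split.
  - now apply hom_id.
  - intros x y Ex Ey. now rewrite f_hom, Ex, Ey, gid_l.
  - intros x Ex. now rewrite hom_inv, Ex, ginv_id.
Qed.

Definition commute {G : Grp} (x y : G) : Prop := x ⋅ y = y ⋅ x.

Definition central {G : Grp} (z : G) : Prop := forall x, commute z x.

Lemma commute_sym {G : Grp} (x y : G) : commute x y -> commute y x.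
Proof. unfold commute. congruence. Qed.

Lemma centralizer_subgroup {G : Grp} (x : G) : is_subgroup (commute x).
Proof.
  unfold commute. repeat split.
  - now rewrite gid_l, gid_r.
  - intros y z Ey Ez. now rewrite gassoc, Ey, <- gassoc, Ez, gassoc.
  - intros y Ey. apply (gcancel_r y). now rewrite gopVK, <- gassoc, Ey, gassoc, ginv_l, gid_l.
Qed.

Lemma commute_op_r {G : Grp} (x y z : G) : commute x y -> commute x z -> commute x (y ⋅ z).
Proof. apply centralizer_subgroup. Qed.

Lemma commute_gpow_r {G : Grp} (x y : G) (n : Z) : commute x y -> commute x (gpow y n).
Proof. apply subgroup_gpow, centralizer_subgroup. Qed.

Lemma commute_gpow_l {G : Grp} (x y : G) (n : Z) : commute x y -> commute (gpow x n) y.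
Proof. intros xy. now apply commute_sym, commute_gpow_r, commute_sym. Qed.

Lemma central_gpow {G : Grp} (z : G) (n : Z) : central z -> central (gpow z n).
Proof. intros z_central x. apply commute_gpow_l, z_central. Qed.

Lemma gop_interchange {G : Grp} (x y z w : G) :
  commute y z -> x ⋅ y ⋅ (z ⋅ w) = x ⋅ z ⋅ (y ⋅ w).
Proof. intros yz. now rewrite !gassoc, <- (gassoc _ x), yz, gassoc. Qed.

Lemma gpow_op {G : Grp} (x y : G) (n : Z) :
  commute x y -> gpow (x ⋅ y) n = gpow x n ⋅ gpow y n.
Proof.
  intros xy. rewrite (gpow_unique (fun n => gpow x n ⋅ gpow y n)).
  - now rewrite !gpow_1.
  - intros a b. rewrite !gpow_add.
    apply gop_interchange, commute_gpow_l. now apply commute_gpow_r.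
Qed.

Lemma gcomm_op {G : Grp} (x y : G) : gcomm x y ⋅ (y ⋅ x) = x ⋅ y.
Proof. unfold gcomm. now rewrite gassoc, !gopVK. Qed.

Lemma gcomm_unique {G : Grp} (x y c : G) : c ⋅ (y ⋅ x) = x ⋅ y -> gcomm x y = c.
Proof. intros E. apply (gcancel_r (y ⋅ x)). now rewrite gcomm_op. Qed.

Lemma gcomm_commute {G : Grp} (x y : G) : commute x y -> gcomm x y = gid.
Proof. intros xy. apply gcomm_unique. now rewrite gid_l. Qed.

Lemma gcomm_inv {G : Grp} (x y : G) : (gcomm x y)⁻¹ = gcomm y x.
Proof. unfold gcomm. now rewrite !ginv_op, !ginv_inv, !gassoc. Qed.

Lemma hom_gcomm {G H : Grp} (f : G -> H) (x y : G) :
  is_hom f -> f (gcomm x y) = gcomm (f x) (f y).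
Proof. intros f_hom. unfold gcomm. now rewrite !f_hom, !(hom_inv f). Qed.

Lemma gcomm_gpow_r {G : Grp} (x y : G) (n : Z) :
  commute (gcomm x y) y -> gcomm x (gpow y n) = gpow (gcomm x y) n.
Proof.
  intros cy. apply gcomm_unique. symmetry. rewrite gassoc. apply conj_eq.
  rewrite (hom_gpow _ _ _ (conj_hom x)), <- gpow_op by easy.
  f_equal. unfold gcomm. now rewrite gopVK.
Qed.

Lemma gcomm_gpow_l {G : Grp} (x y : G) (n : Z) :
  commute (gcomm x y) x -> gcomm (gpow x n) y = gpow (gcomm x y) n.
Proof.
  intros cx. rewrite <- gcomm_inv, gcomm_gpow_r, <- !gpow_m1, gpow_gpow, Z.mul_comm,
    <- gpow_gpow, gpow_m1, gcomm_inv; [easy|].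
  now rewrite <- gcomm_inv, <- gpow_m1; apply commute_gpow_l.
Qed.

Lemma gcomm_gpow {G : Grp} (x y : G) (m n : Z) :
  commute (gcomm x y) x -> commute (gcomm x y) y ->
  gcomm (gpow x m) (gpow y n) = gpow (gcomm x y) (m * n).
Proof.
  intros cx cy. rewrite gcomm_gpow_r; rewrite gcomm_gpow_l by easy.
  - apply gpow_gpow.
  - now apply commute_gpow_l.
Qed.

Lemma commsub_incl {G : Grp} (K L N : G -> Prop) :
  is_subgroup N -> (forall k l, K k -> L l -> N (gcomm k l)) ->
  forall x, commsub K L x -> N x.
Proof.
  intros N_sub KL x Kx. apply Kx; [easy|]. intros y (k & l & Kk & Ll & ->). auto.
Qed.

(** * The group [Z^2 x| Z] *)

Definition vadd (v w : Z * Z) : Z * Z := (fst v + fst w, snd v + snd w).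

Definition vopp (v : Z * Z) : Z * Z := (- fst v, - snd v).

Definition M2det (A : M2) : Z := m11 A * m22 A - m12 A * m21 A.

Definition M2tr (A : M2) : Z := m11 A + m22 A.

Ltac coordwise := repeat (apply pair_equal_spec; split).

Ltac coord_ring := coordwise; cbn -[Z.add Z.mul Z.opp]; ring.

Definition Z_grp : Grp.
Proof. refine (Build_Grp Z Z.add 0 Z.opp _ _ _); intros; ring. Defined.

Lemma Z_grp_gpow_1 (n : Z) : @gpow Z_grp 1 n = n.
Proof. symmetry. now apply (gpow_unique (fun n => n : Z_grp)). Qed.

Definition Z2_grp : Grp.
Proof.
  refine (Build_Grp (Z * Z) vadd (0, 0) vopp _ _ _).
  - intros v w x. coord_ring.
  - now intros [a b].
  - intros [a b]. unfold vadd, vopp; simpl. coord_ring.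
Defined.

Lemma Z2_grp_gpow (v : Z2_grp) (n : Z) : gpow v n = (fst v * n, snd v * n).
Proof.
  symmetry. destruct v as [a b].
  transitivity (gpow ((a * 1, b * 1) : Z2_grp) n); [|now rewrite !Z.mul_1_r].
  apply (gpow_unique (fun n => (a * n, b * n) : Z2_grp)).
  intros m k. coord_ring.
Qed.

Lemma M2app_hom (A : M2) : is_hom (M2app A : Z2_grp -> Z2_grp).
Proof. intros v w. coord_ring. Qed.

Lemma M2app_mul (A B : M2) (v : Z * Z) : M2app (M2mul A B) v = M2app A (M2app B v).
Proof. coord_ring. Qed.

Lemma M2app_id (v : Z * Z) : M2app M2id v = v.
Proof. destruct v as [a b]. coord_ring. Qed.

Lemma M2app_inv1_r (A : M2) (v : Z * Z) : M2det A = 1 -> M2app A (M2app (M2inv1 A) v) = v.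
Proof.
  intros det_A. rewrite <- M2app_mul. rewrite <- (M2app_id v) at 2. f_equal.
  unfold M2mul, M2id, M2det in *; simpl. f_equal; lia.
Qed.

Lemma M2app_inv1_l (A : M2) (v : Z * Z) : M2det A = 1 -> M2app (M2inv1 A) (M2app A v) = v.
Proof.
  intros det_A. rewrite <- M2app_mul. rewrite <- (M2app_id v) at 2. f_equal.
  unfold M2mul, M2id, M2det in *; simpl. f_equal; lia.
Qed.

Lemma M2app_pow (A : M2) (n : Z) (v : Z * Z) :
  M2app (M2pow A n) v = ziter (M2app A) (M2app (M2inv1 A)) n v.
Proof.
  assert (E : forall B k, M2app (M2pow_nat B k) v = Nat.iter k (M2app B) v).
  { intros B k. induction k as [|k IH]; [apply M2app_id|].
    now rewrite Nat.iter_succ, <- IH, <- M2app_mul. }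
  destruct n; [apply M2app_id|apply E..].
Qed.

Lemma M2app_pow_1 (A : M2) (v : Z * Z) : M2app (M2pow A 1) v = M2app A v.
Proof. now rewrite M2app_pow. Qed.

Lemma M2app_pow_succ (A : M2) (n : Z) (v : Z * Z) : M2det A = 1 ->
  M2app (M2pow A (n + 1)) v = M2app A (M2app (M2pow A n) v).
Proof.
  intros det_A. rewrite !M2app_pow. apply ziter_succ. intros w. now apply M2app_inv1_r.
Qed.

Lemma M2app_pow_add (A : M2) (m n : Z) (v : Z * Z) : M2det A = 1 ->
  M2app (M2pow A (m + n)) v = M2app (M2pow A m) (M2app (M2pow A n) v).
Proof.
  intros det_A. rewrite !M2app_pow. apply ziter_add; intros w;
    [now apply M2app_inv1_r|now apply M2app_inv1_l].
Qed.

Lemma GammaS_mul_pair (A : M2) (v w : Z * Z) (m n : Z) :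
  GammaS_mul A (v, m) (w, n) = (vadd v (M2app (M2pow A m) w), m + n).
Proof. reflexivity. Qed.

Definition GammaS_inv (A : M2) (a : Z * Z * Z) : Z * Z * Z :=
  (M2app (M2pow A (- snd a)) (vopp (fst a)), - snd a).

Definition GammaS_grp (A : M2) (det_A : M2det A = 1) : Grp.
Proof.
  refine (Build_Grp (Z * Z * Z) (GammaS_mul A) GammaS_id (GammaS_inv A) _ _ _).
  - intros [v l] [w m] [x n]. rewrite !GammaS_mul_pair, Z.add_assoc. f_equal.
    rewrite M2app_pow_add by easy.
    etransitivity; [|apply (gassoc Z2_grp)]. apply f_equal. apply (M2app_hom (M2pow A l)).
  - intros [v m]. unfold GammaS_id. rewrite GammaS_mul_pair, M2app_id.
    f_equal. apply (gid_l Z2_grp).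
  - intros [v m]. unfold GammaS_inv; cbn [fst snd]. rewrite GammaS_mul_pair, Z.add_opp_diag_l.
    unfold GammaS_id. f_equal.
    rewrite <- (M2app_hom (M2pow A (- m)) : forall v w, _ = vadd _ _).
    etransitivity; [apply f_equal, (ginv_l Z2_grp)|]. apply (hom_id _ (M2app_hom _)).
Defined.

Section GammaS.

Context {A : M2} (det_A : M2det A = 1).

Notation GammaS := (GammaS_grp A det_A).

Lemma GammaS_translation_op (v w : Z * Z) :
  ((v, 0) : GammaS) ⋅ (w, 0) = (vadd v w, 0).
Proof. cbn [gop GammaS_grp]. now rewrite GammaS_mul_pair, M2app_id. Qed.

Lemma GammaS_translation_hom : is_hom (fun v : Z2_grp => (v, 0) : GammaS).
Proof. intros v w. symmetry. apply GammaS_translation_op. Qed.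

Lemma GammaS_translation_gpow (v : Z * Z) (n : Z) :
  gpow ((v, 0) : GammaS) n = ((fst v * n, snd v * n), 0).
Proof.
  pose proof (hom_gpow _ (v : Z2_grp) n GammaS_translation_hom) as E.
  rewrite Z2_grp_gpow in E. exact (eq_sym E).
Qed.

Lemma GammaS_translation_commute (v w : Z * Z) : commute ((v, 0) : GammaS) (w, 0).
Proof. unfold commute. rewrite !GammaS_translation_op. coord_ring. Qed.

Lemma GammaS_basis_word (a b : Z) :
  gpow ((1, 0, 0) : GammaS) a ⋅ gpow ((0, 1, 0) : GammaS) b = (a, b, 0).
Proof. rewrite !GammaS_translation_gpow, GammaS_translation_op. coord_ring. Qed.

Lemma GammaS_snd_hom : is_hom (snd : GammaS -> Z_grp).
Proof. now intros [v m] [w n]. Qed.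

Lemma GammaS_gcomm_translation (w v : Z * Z) (n : Z) :
  gcomm ((w, n) : GammaS) (v, 0) = (vadd (M2app (M2pow A n) v) (vopp v), 0).
Proof.
  apply gcomm_unique. cbn [gop GammaS_grp]. rewrite !GammaS_mul_pair. cbn [M2pow].
  rewrite !M2app_id. destruct (M2app (M2pow A n) v) as [a b].
  unfold vadd, vopp; cbn [fst snd]. coord_ring.
Qed.

Lemma GammaS_pres_rel :
  pres_rel A 0 0 0 ((1, 0, 0) : GammaS) (0, 1, 0) (0, 0, 1) gid.
Proof.
  assert (E : forall v : Z * Z,
    ((0, 0, 1) : GammaS) ⋅ (v, 0) = ((M2app A v, 0) : GammaS) ⋅ (0, 0, 1)).
  { intros v. cbn [gop GammaS_grp]. rewrite !GammaS_mul_pair, M2app_pow_1. cbn [M2pow].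
    rewrite M2app_id. unfold vadd; cbn [fst snd]. coord_ring. }
  repeat apply conj; rewrite ?gpow_0, ?gid_l, ?gid_r; [|easy..| |].
  - now apply gcomm_commute, GammaS_translation_commute.
  - apply conj_eq. rewrite E, GammaS_basis_word.
    apply (f_equal (fun x => x ⋅ _)). coord_ring.
  - apply conj_eq. rewrite E, GammaS_basis_word.
    apply (f_equal (fun x => x ⋅ _)). coord_ring.
Qed.

End GammaS.

(** * Heisenberg groups *)

Definition monomial {G : Grp} (t1 t2 tau : G) (e : Z * Z * Z) : G :=
  gpow t1 (fst (fst e)) ⋅ gpow t2 (snd (fst e)) ⋅ gpow tau (snd e).

Lemma monomial_t1 {G : Grp} (t1 t2 tau : G) : monomial t1 t2 tau (1, 0, 0) = t1.
Proof. unfold monomial; cbn [fst snd]. now rewrite gpow_1, !gpow_0, !gid_r. Qed.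

Lemma monomial_t2 {G : Grp} (t1 t2 tau : G) : monomial t1 t2 tau (0, 1, 0) = t2.
Proof. unfold monomial; cbn [fst snd]. now rewrite gpow_1, !gpow_0, gid_l, gid_r. Qed.

Lemma monomial_tau_gpow {G : Grp} (t1 t2 tau : G) (n : Z) :
  monomial t1 t2 tau (0, 0, n) = gpow tau n.
Proof. unfold monomial; cbn [fst snd]. now rewrite !gpow_0, !gid_l. Qed.

Lemma monomial_tau {G : Grp} (t1 t2 tau : G) : monomial t1 t2 tau (0, 0, 1) = tau.
Proof. now rewrite monomial_tau_gpow, gpow_1. Qed.

Lemma hom_monomial {G H : Grp} (f : G -> H) (t1 t2 tau : G) (e : Z * Z * Z) :
  is_hom f -> f (monomial t1 t2 tau e) = monomial (f t1) (f t2) (f tau) e.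
Proof. intros f_hom. unfold monomial. now rewrite !f_hom, !(hom_gpow f). Qed.

(* [(a, b, c)] stands for [t1^a t2^b tau^c], and [t2 t1 = t1 t2 tau^(-q)]. *)
Definition heis (q : Z) : Grp.
Proof.
  refine (Build_Grp (Z * Z * Z)
    (fun x y => (vadd (fst x) (fst y), snd x + snd y - q * snd (fst x) * fst (fst y)))
    (0, 0, 0)
    (fun x => (vopp (fst x), - snd x - q * fst (fst x) * snd (fst x))) _ _ _).
  - intros [[a b] c] [[a' b'] c'] [[a'' b''] c'']. coord_ring.
  - intros [[a b] c]. coord_ring.
  - intros [[a b] c]. coord_ring.
Defined.

Definition heis_rel (q : Z) {G : Grp} (t1 t2 tau : G) : Prop :=
  gcomm t1 t2 = gpow tau q /\ commute tau t1 /\ commute tau t2.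

Lemma heis_rel_swap {G : Grp} (t1 t2 tau : G) (q a b : Z) : heis_rel q t1 t2 tau ->
  gpow t2 b ⋅ gpow t1 a = gpow t1 a ⋅ gpow t2 b ⋅ gpow tau (- q * b * a).
Proof.
  intros (comm & tau_t1 & tau_t2).
  assert (comm' : gcomm t2 t1 = gpow tau (- q)).
  { rewrite <- gcomm_inv, comm, <- gpow_m1, gpow_gpow. f_equal. ring. }
  rewrite <- gcomm_op, gcomm_gpow, comm', gpow_gpow by
    (rewrite comm'; now apply commute_gpow_l).
  rewrite <- Z.mul_assoc.
  apply commute_op_r; apply commute_gpow_r; now apply commute_gpow_l.
Qed.

Lemma monomial_hom {G : Grp} (t1 t2 tau : G) (q : Z) :
  heis_rel q t1 t2 tau -> is_hom (monomial t1 t2 tau : heis q -> G).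
Proof.
  intros rel [[a b] c] [[a' b'] c']. unfold monomial; cbn [gop heis vadd fst snd].
  assert (tau_1 : forall m n, commute (gpow tau m) (gpow t1 n))
    by (intros; apply commute_gpow_r, commute_gpow_l; apply rel).
  assert (tau_2 : forall m n, commute (gpow tau m) (gpow t2 n))
    by (intros; apply commute_gpow_r, commute_gpow_l; apply rel).
  rewrite (gop_interchange _ (gpow tau c)) by (apply commute_op_r; auto).
  rewrite (gassoc _ (_ ⋅ _) (gpow t1 a')), <- (gassoc _ (gpow t1 a)).
  rewrite (heis_rel_swap t1 t2 tau q) by easy.
  rewrite <- !gassoc, (gassoc _ _ (gpow t2 b')), tau_2.
  rewrite !gassoc, <- gpow_add, <- (gassoc _ _ (gpow t2 b)), <- gpow_add.
  rewrite <- !(gassoc _ _ (gpow tau _)), <- !gpow_add.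
  do 2 f_equal. ring.
Qed.

Lemma heis_monomial (q : Z) (x : heis q) :
  monomial ((1, 0, 0) : heis q) (0, 1, 0) (0, 0, 1) x = x.
Proof.
  assert (pow1 : forall n, gpow ((1, 0, 0) : heis q) n = (n, 0, 0)).
  { intros n. symmetry. apply (gpow_unique (fun n => (n, 0, 0) : heis q)).
    intros a b. coord_ring. }
  assert (pow2 : forall n, gpow ((0, 1, 0) : heis q) n = (0, n, 0)).
  { intros n. symmetry. apply (gpow_unique (fun n => (0, n, 0) : heis q)).
    intros a b. coord_ring. }
  assert (pow_tau : forall n, gpow ((0, 0, 1) : heis q) n = (0, 0, n)).
  { intros n. symmetry. apply (gpow_unique (fun n => (0, 0, n) : heis q)).
    intros a b. coord_ring. }
  destruct x as [[a b] c]. unfold monomial. rewrite pow1, pow2, pow_tau. coord_ring.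
Qed.

Lemma heis_hom_ext {q : Z} {H : Grp} (f g : heis q -> H) : is_hom f -> is_hom g ->
  f (1, 0, 0) = g (1, 0, 0) -> f (0, 1, 0) = g (0, 1, 0) -> f (0, 0, 1) = g (0, 0, 1) ->
  forall x, f x = g x.
Proof.
  intros f_hom g_hom E1 E2 E3 x.
  rewrite <- (heis_monomial q x), (hom_monomial f), (hom_monomial g) by easy.
  now rewrite E1, E2, E3.
Qed.

Lemma heis_tau_gpow (q n : Z) : gpow ((0, 0, 1) : heis q) n = (0, 0, n).
Proof. rewrite <- (monomial_tau_gpow ((1, 0, 0) : heis q) (0, 1, 0)). apply heis_monomial. Qed.

Lemma heis_op_tau (q n : Z) (x : heis q) : x ⋅ (0, 0, n) = (fst x, snd x + n).
Proof. destruct x as [[a b] c]. coord_ring. Qed.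

Lemma heis_gcomm (q : Z) (x y : heis q) :
  gcomm x y = (0, 0, q * (fst (fst x) * snd (fst y) - snd (fst x) * fst (fst y))).
Proof.
  apply gcomm_unique. destruct x as [[a b] c], y as [[a' b'] c']. coord_ring.
Qed.

Section HeisenbergAutomorphism.

Variables (A : M2) (q m1 m2 : Z).
Hypothesis det_A : M2det A = 1.

(* Conjugation by [t3], as prescribed by the presentation. *)
Definition heis_aut : heis q -> heis q :=
  monomial ((m11 A, m21 A, m1) : heis q) (m12 A, m22 A, m2) (0, 0, 1).

Definition heis_aut_inv (x : heis q) : heis q :=
  let v := M2app (M2inv1 A) (fst x) in (v, snd x - snd (heis_aut (v, 0))).

Lemma heis_aut_hom : is_hom heis_aut.
Proof.
  apply monomial_hom. repeat split; try coord_ring.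
  rewrite heis_gcomm, heis_tau_gpow. apply pair_equal_spec. split; [easy|].
  transitivity (q * M2det A); [unfold M2det; cbn -[Z.mul]; ring|]. rewrite det_A. ring.
Qed.

Lemma heis_aut_fst (x : heis q) : fst (heis_aut x) = M2app A (fst x).
Proof.
  apply (heis_hom_ext (H := Z2_grp) (fun x => fst (heis_aut x)) (fun x => M2app A (fst x))).
  - intros y z. now rewrite heis_aut_hom.
  - intros y z. now rewrite <- (M2app_hom A).
  - unfold heis_aut. rewrite monomial_t1. coord_ring.
  - unfold heis_aut. rewrite monomial_t2. coord_ring.
  - unfold heis_aut. rewrite monomial_tau. coord_ring.
Qed.

Lemma heis_aut_pair (v : Z * Z) (c : Z) :
  heis_aut (v, c) = (M2app A v, snd (heis_aut (v, 0)) + c).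
Proof.
  rewrite <- (heis_aut_fst (v, 0) : _ = M2app A v).
  rewrite <- heis_op_tau, <- (heis_tau_gpow q c).
  rewrite <- (monomial_tau_gpow ((m11 A, m21 A, m1) : heis q) (m12 A, m22 A, m2)).
  fold (heis_aut (0, 0, c)). rewrite <- heis_aut_hom. f_equal.
  symmetry. apply heis_op_tau.
Qed.

Lemma heis_autK (x : heis q) : heis_aut_inv (heis_aut x) = x.
Proof.
  destruct x as [v c]. rewrite heis_aut_pair. unfold heis_aut_inv; cbn [fst snd].
  now rewrite M2app_inv1_l, Z.add_simpl_l.
Qed.

Lemma heis_aut_invK (x : heis q) : heis_aut (heis_aut_inv x) = x.
Proof.
  destruct x as [v c]. unfold heis_aut_inv; cbn [fst snd].
  now rewrite heis_aut_pair, M2app_inv1_r, Zplus_minus.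
Qed.

End HeisenbergAutomorphism.

(** * Semidirect products with [Z] *)

Section SemidirectZ.

Context {N : Grp} {f g : N -> N} (f_hom : is_hom f)
  (fg : forall x, f (g x) = x) (gf : forall x, g (f x) = x).

Definition semidirectZ : Grp.
Proof.
  refine (Build_Grp (N * Z)
    (fun x y => (fst x ⋅ ziter f g (snd x) (fst y), snd x + snd y))
    (gid, 0) (fun x => (ziter f g (- snd x) (fst x)⁻¹, - snd x)) _ _ _).
  - intros [x l] [y m] [z n]; simpl.
    now rewrite (ziter_hom f g l f_hom fg gf), ziter_add, gassoc, Z.add_assoc.
  - intros [x n]; simpl. now rewrite gid_l.
  - intros [x n]; simpl.
    now rewrite <- (ziter_hom f g (- n) f_hom fg gf), ginv_l,
      (hom_id _ (ziter_hom f g (- n) f_hom fg gf)), Z.add_opp_diag_l.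
Defined.

Definition semidirectZ_incl (x : N) : semidirectZ := (x, 0).

Definition semidirectZ_gen : semidirectZ := (gid, 1).

Definition semidirectZ_lift {G : Grp} (phi : N -> G) (t : G) (x : semidirectZ) : G :=
  phi (fst x) ⋅ gpow t (snd x).

Lemma semidirectZ_incl_hom : is_hom semidirectZ_incl.
Proof. easy. Qed.

Lemma semidirectZ_gen_gpow (n : Z) : gpow semidirectZ_gen n = (gid, n).
Proof.
  symmetry. apply (gpow_unique (fun n => (gid, n) : semidirectZ)).
  intros a b. simpl. now rewrite (hom_id _ (ziter_hom f g a f_hom fg gf)), gid_l.
Qed.

Lemma semidirectZ_gen_conj (x : N) :
  semidirectZ_gen ⋅ semidirectZ_incl x = semidirectZ_incl (f x) ⋅ semidirectZ_gen.
Proof. simpl. now rewrite gid_l, gid_r. Qed.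

Lemma semidirectZ_decomp (x : semidirectZ) :
  x = semidirectZ_incl (fst x) ⋅ gpow semidirectZ_gen (snd x).
Proof. rewrite semidirectZ_gen_gpow. destruct x as [x n]. simpl. now rewrite gid_r. Qed.

Lemma semidirectZ_lift_hom {G : Grp} (phi : N -> G) (t : G) :
  is_hom phi -> (forall x, t ⋅ phi x = phi (f x) ⋅ t) -> is_hom (semidirectZ_lift phi t).
Proof.
  intros phi_hom t_phi.
  assert (tn_phi : forall n x, gpow t n ⋅ phi x = phi (ziter f g n x) ⋅ gpow t n).
  { intros n x. Z_induction n; [now rewrite gpow_0, gid_l, gid_r|].
    rewrite gpow_succ, ziter_succ, gassoc, <- t_phi, <- !gassoc by easy.
    split; intros E; [now rewrite E|]. now apply gcancel_l in E. }
  intros [x m] [y n]. unfold semidirectZ_lift; simpl.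
  now rewrite phi_hom, gpow_add, !gassoc, <- !(gassoc _ (phi x)), tn_phi.
Qed.

Lemma semidirectZ_hom_ext {G : Grp} (h k : semidirectZ -> G) : is_hom h -> is_hom k ->
  (forall x, h (semidirectZ_incl x) = k (semidirectZ_incl x)) ->
  h semidirectZ_gen = k semidirectZ_gen -> forall x, h x = k x.
Proof.
  intros h_hom k_hom E_incl E_gen x. rewrite (semidirectZ_decomp x), h_hom, k_hom.
  now rewrite (hom_gpow h), (hom_gpow k), E_incl, E_gen.
Qed.

End SemidirectZ.

(** * The presented group *)

Section PresentedGroup.

Context {A : M2} (det_A : M2det A = 1) (q m1 m2 : Z).

Definition tGamma : Grp :=
  semidirectZ (heis_aut_hom A q m1 m2 det_A) (heis_aut_invK A q m1 m2 det_A)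
    (heis_autK A q m1 m2 det_A).

Definition tGamma_incl : heis q -> tGamma := semidirectZ_incl _ _ _.

Definition tGamma_t1 : tGamma := tGamma_incl (1, 0, 0).
Definition tGamma_t2 : tGamma := tGamma_incl (0, 1, 0).
Definition tGamma_t3 : tGamma := semidirectZ_gen _ _ _.
Definition tGamma_tau : tGamma := tGamma_incl (0, 0, 1).

Definition tGamma_pi (x : tGamma) : Z * Z * Z := (fst (fst x), snd x).

Lemma tGamma_incl_hom : is_hom tGamma_incl.
Proof. apply semidirectZ_incl_hom. Qed.

Lemma tGamma_incl_monomial (x : heis q) :
  tGamma_incl x = monomial tGamma_t1 tGamma_t2 tGamma_tau x.
Proof.
  unfold tGamma_t1, tGamma_t2, tGamma_tau.
  now rewrite <- (hom_monomial _ _ _ _ _ tGamma_incl_hom), heis_monomial.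
Qed.

Lemma tGamma_t3_conj (x : heis q) :
  tGamma_t3 ⋅ tGamma_incl x = tGamma_incl (heis_aut A q m1 m2 x) ⋅ tGamma_t3.
Proof. apply semidirectZ_gen_conj. Qed.

Lemma tGamma_pres_rel : pres_rel A q m1 m2 tGamma_t1 tGamma_t2 tGamma_t3 tGamma_tau.
Proof.
  assert (tau_central : forall x, commute ((0, 0, 1) : heis q) x)
    by (intros [[a b] c]; unfold commute; coord_ring).
  repeat apply conj.
  - unfold tGamma_t1, tGamma_t2, tGamma_tau.
    rewrite <- (hom_gcomm _ _ _ tGamma_incl_hom), <- (hom_gpow _ _ _ tGamma_incl_hom).
    f_equal. rewrite heis_gcomm, heis_tau_gpow. coord_ring.
  - unfold tGamma_t1, tGamma_tau. rewrite <- !tGamma_incl_hom. f_equal. apply tau_central.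
  - unfold tGamma_t2, tGamma_tau. rewrite <- !tGamma_incl_hom. f_equal. apply tau_central.
  - unfold tGamma_tau. rewrite tGamma_t3_conj. unfold heis_aut. now rewrite monomial_tau.
  - apply conj_eq. unfold tGamma_t1 at 1. rewrite tGamma_t3_conj.
    unfold heis_aut. now rewrite monomial_t1, tGamma_incl_monomial.
  - apply conj_eq. unfold tGamma_t2 at 1. rewrite tGamma_t3_conj.
    unfold heis_aut. now rewrite monomial_t2, tGamma_incl_monomial.
Qed.

End PresentedGroup.

Lemma hom_pres_rel {A : M2} {q m1 m2 : Z} {G H : Grp} (f : G -> H) (t1 t2 t3 tau : G) :
  is_hom f -> pres_rel A q m1 m2 t1 t2 t3 tau ->
  pres_rel A q m1 m2 (f t1) (f t2) (f t3) (f tau).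
Proof.
  intros f_hom (comm & tau_t1 & tau_t2 & tau_t3 & rel1 & rel2).
  unfold pres_rel. rewrite <- !(hom_gpow f), <- !(hom_inv f) by easy.
  rewrite <- !f_hom, <- (hom_gcomm f), comm, tau_t1, tau_t2, tau_t3, rel1, rel2; easy.
Qed.

Lemma pres_rel_heis_rel {A : M2} {q m1 m2 : Z} {G : Grp} {t1 t2 t3 tau : G} :
  pres_rel A q m1 m2 t1 t2 t3 tau -> heis_rel q t1 t2 tau.
Proof. now intros (comm & tau_t1 & tau_t2 & _). Qed.

Lemma pres_rel_conj_monomial {A : M2} (det_A : M2det A = 1) {q m1 m2 : Z} {G : Grp}
  {t1 t2 t3 tau : G} (x : heis q) : pres_rel A q m1 m2 t1 t2 t3 tau ->
  t3 ⋅ monomial t1 t2 tau x = monomial t1 t2 tau (heis_aut A q m1 m2 x) ⋅ t3.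
Proof.
  intros rel. pose proof (monomial_hom _ _ _ _ (pres_rel_heis_rel rel)) as mon_hom.
  destruct rel as (_ & _ & _ & tau_t3 & conj1 & conj2). apply conj_eq.
  apply (heis_hom_ext (fun x => t3 ⋅ monomial t1 t2 tau x ⋅ t3⁻¹)
           (fun x => monomial t1 t2 tau (heis_aut A q m1 m2 x))).
  - intros y z. now rewrite mon_hom, (conj_hom t3).
  - intros y z. now rewrite (heis_aut_hom A q m1 m2 det_A), mon_hom.
  - unfold heis_aut. now rewrite !monomial_t1.
  - unfold heis_aut. now rewrite !monomial_t2.
  - unfold heis_aut. rewrite !monomial_tau. now apply conj_eq.
Qed.

Lemma tGamma_presented {A : M2} (det_A : M2det A = 1) (q m1 m2 : Z) :
  is_presented A q m1 m2 (tGamma det_A q m1 m2)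
    (tGamma_t1 det_A q m1 m2) (tGamma_t2 det_A q m1 m2)
    (tGamma_t3 det_A q m1 m2) (tGamma_tau det_A q m1 m2).
Proof.
  split; [apply tGamma_pres_rel|]. intros H a1 a2 a3 b rel. split.
  - exists (semidirectZ_lift _ _ _ (monomial a1 a2 b : heis q -> H) a3). split.
    + apply semidirectZ_lift_hom.
      * exact (monomial_hom _ _ _ _ (pres_rel_heis_rel rel)).
      * intros x. now apply pres_rel_conj_monomial.
    + unfold semidirectZ_lift; simpl.
      now rewrite monomial_t1, monomial_t2, monomial_tau, monomial_tau_gpow, !gid_r, gid_l.
  - intros f g f_hom g_hom E1 E2 E3 E_tau.
    apply semidirectZ_hom_ext; try easy.
    apply (heis_hom_ext (fun x => f (tGamma_incl det_A q m1 m2 x))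
             (fun x => g (tGamma_incl det_A q m1 m2 x))); try easy.
    + intros x y. now rewrite tGamma_incl_hom.
    + intros x y. now rewrite tGamma_incl_hom.
Qed.

Lemma presented_hom_ext {A : M2} {q m1 m2 : Z} {P H : Grp} {t1 t2 t3 tau : P}
  (f g : P -> H) : is_presented A q m1 m2 P t1 t2 t3 tau -> is_hom f -> is_hom g ->
  f t1 = g t1 -> f t2 = g t2 -> f t3 = g t3 -> f tau = g tau -> forall x, f x = g x.
Proof.
  intros [rel pres] f_hom.
  exact (proj2 (pres _ _ _ _ _ (hom_pres_rel f _ _ _ _ f_hom rel)) f g f_hom).
Qed.

Lemma presented_tau_central {A : M2} {q m1 m2 : Z} {P : Grp} {t1 t2 t3 tau : P} :
  is_presented A q m1 m2 P t1 t2 t3 tau -> central tau.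
Proof.
  intros pres x. apply conj_eq.
  apply (presented_hom_ext (fun x => tau ⋅ x ⋅ tau⁻¹) (fun x => x) pres);
    try apply conj_hom; try apply conj_eq; easy || apply pres.
Qed.

Lemma presented_iso {A : M2} {q m1 m2 : Z} {P Q : Grp} {t1 t2 t3 tau : P}
  {s1 s2 s3 sigma : Q} : is_presented A q m1 m2 P t1 t2 t3 tau ->
  is_presented A q m1 m2 Q s1 s2 s3 sigma ->
  exists (f : P -> Q) (g : Q -> P), inverse_homs f g /\
    f t1 = s1 /\ f t2 = s2 /\ f t3 = s3 /\ f tau = sigma.
Proof.
  intros P_pres Q_pres.
  destruct (proj1 (proj2 P_pres _ _ _ _ _ (proj1 Q_pres)))
    as (f & f_hom & f1 & f2 & f3 & f_tau).
  destruct (proj1 (proj2 Q_pres _ _ _ _ _ (proj1 P_pres)))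
    as (g & g_hom & g1 & g2 & g3 & g_tau).
  exists f, g. repeat split; try easy.
  - apply (presented_hom_ext (fun x => g (f x)) (fun x => x) P_pres); [|easy|congruence..].
    intros x y. now rewrite f_hom, g_hom.
  - apply (presented_hom_ext (fun x => f (g x)) (fun x => x) Q_pres); [|easy|congruence..].
    intros x y. now rewrite g_hom, f_hom.
Qed.

(** * Central extensions *)

Definition lifts_basis {G : Grp} (pi : G -> Z * Z * Z) (t1 t2 t3 : G) : Prop :=
  pi t1 = (1, 0, 0) /\ pi t2 = (0, 1, 0) /\ pi t3 = (0, 0, 1).

Lemma tGamma_central_ext {A : M2} (det_A : M2det A = 1) (q m1 m2 : Z) :
  is_central_ext A (tGamma det_A q m1 m2) (gpow (tGamma_tau det_A q m1 m2))
    (tGamma_pi det_A q m1 m2).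
Proof.
  assert (tau_gpow : forall n, gpow (tGamma_tau det_A q m1 m2) n = ((0, 0, n), 0)).
  { intros n. unfold tGamma_tau.
    rewrite <- (hom_gpow _ _ n (tGamma_incl_hom det_A q m1 m2)). now rewrite heis_tau_gpow. }
  repeat apply conj.
  - apply gpow_add.
  - intros a b. rewrite !tau_gpow. now intros [= E].
  - intros n.
    apply (central_gpow _ n (presented_tau_central (tGamma_presented det_A q m1 m2))).
  - intros [x m] [y n]. unfold tGamma_pi at 2 3; cbn [fst snd].
    rewrite GammaS_mul_pair, M2app_pow.
    rewrite <- (ziter_semiconj fst (heis_aut A q m1 m2) (heis_aut_inv A q m1 m2));
      [easy|now apply heis_aut_fst|easy].
  - intros [v n]. now exists ((v, 0), n).
  - intros [[v c] n]. unfold tGamma_pi, GammaS_id; cbn [fst snd]. split.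
    + intros [= -> ->]. exists c. now rewrite tau_gpow.
    + intros [k E]. rewrite tau_gpow in E. now injection E as -> _ ->.
Qed.

Lemma central_ext_iso {A : M2} {G H : Grp} (f : G -> H) (g : H -> G)
  (iota : Z -> G) (iota' : Z -> H) (pi : H -> Z * Z * Z) :
  inverse_homs f g -> (forall n, f (iota n) = iota' n) ->
  is_central_ext A H iota' pi -> is_central_ext A G iota (fun x => pi (f x)).
Proof.
  intros (f_hom & g_hom & gf & fg) f_iota
    (iota_add & iota_inj & iota_central & pi_hom & pi_surj & pi_ker).
  assert (iota_g : forall n, iota n = g (iota' n)) by (intros n; now rewrite <- f_iota, gf).
  repeat apply conj.
  - intros a b. now rewrite !iota_g, iota_add, g_hom.
  - intros a b E. apply iota_inj. now rewrite <- !f_iota, E.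
  - intros n x. rewrite iota_g, <- (gf x), <- !g_hom. now rewrite iota_central.
  - intros x y. now rewrite f_hom, pi_hom.
  - intros c. destruct (pi_surj c) as [y E]. exists (g y). now rewrite fg.
  - intros x. rewrite pi_ker. split; intros [n E]; exists n.
    + now rewrite iota_g, <- E, gf.
    + now rewrite E, f_iota.
Qed.

Lemma presented_central_ext {A : M2} (det_A : M2det A = 1) {q m1 m2 : Z} {P : Grp}
  {t1 t2 t3 tau : P} : is_presented A q m1 m2 P t1 t2 t3 tau ->
  exists pi, is_central_ext A P (gpow tau) pi /\ lifts_basis pi t1 t2 t3.
Proof.
  intros pres. destruct (presented_iso pres (tGamma_presented det_A q m1 m2))
    as (f & g & fg & f1 & f2 & f3 & f_tau).
  exists (fun x => tGamma_pi det_A q m1 m2 (f x)). split.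
  - apply (central_ext_iso f g (gpow tau) (gpow (tGamma_tau det_A q m1 m2))); [easy| |].
    + intros n. rewrite <- f_tau. apply hom_gpow, fg.
    + apply tGamma_central_ext.
  - unfold lifts_basis. now rewrite f1, f2, f3.
Qed.

Section CentralExtension.

Context {A : M2} (det_A : M2det A = 1) {G : Grp} {iota : Z -> G} {pi : G -> Z * Z * Z}
  (ext : is_central_ext A G iota pi).

Notation GammaS := (GammaS_grp A det_A).

Lemma ext_pi_hom : is_hom (pi : G -> GammaS).
Proof. intros x y. apply ext. Qed.

Lemma ext_iota_central (n : Z) : central (iota n).
Proof. intros x. apply ext. Qed.

Lemma ext_iota_gpow (n : Z) : iota n = gpow (iota 1) n.
Proof. apply gpow_unique, ext. Qed.

Lemma ext_iota_0 : iota 0 = gid.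
Proof. apply ext_iota_gpow. Qed.

Lemma ext_iota_injective : Injective iota.
Proof. intros m n. apply ext. Qed.

Lemma ext_pi_surjective : Surjective pi.
Proof. intros c. apply ext. Qed.

Lemma ext_pi_iota (n : Z) : pi (iota n) = GammaS_id.
Proof. apply ext. now exists n. Qed.

Lemma ext_pi_op_iota (x : G) (n : Z) : pi (x ⋅ iota n) = pi x.
Proof. rewrite ext_pi_hom, ext_pi_iota. apply (@gid_r GammaS). Qed.

Lemma ext_fiber (x y : G) : pi x = pi y -> exists n, x = y ⋅ iota n.
Proof.
  intros E. assert (ker : pi (y⁻¹ ⋅ x) = GammaS_id).
  { rewrite ext_pi_hom, (hom_inv (pi : G -> GammaS)) by apply ext_pi_hom.
    rewrite E. apply (ginv_l GammaS). }
  apply ext in ker. destruct ker as [n En]. exists n. now rewrite <- En, gassoc, ginv_r, gid_l.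
Qed.

Context {t1 t2 t3 : G} (lifts : lifts_basis pi t1 t2 t3).

Lemma ext_pi_monomial (v : Z * Z) (c : Z) : pi (monomial t1 t2 (iota 1) (v, c)) = (v, 0).
Proof.
  destruct lifts as (pi1 & pi2 & _). unfold monomial; cbn [fst snd].
  rewrite <- ext_iota_gpow, ext_pi_op_iota, ext_pi_hom.
  rewrite !(hom_gpow (pi : G -> GammaS)) by apply ext_pi_hom.
  rewrite pi1, pi2, GammaS_basis_word. now destruct v.
Qed.

Lemma ext_monomial_of_snd_pi (x : G) :
  snd (pi x) = 0 -> exists e, x = monomial t1 t2 (iota 1) e.
Proof.
  intros E. destruct (pi x) as [v n] eqn:E'. cbn [snd] in E. subst n.
  destruct (ext_fiber x (monomial t1 t2 (iota 1) (v, 0))) as [c Ex].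
  { now rewrite ext_pi_monomial. }
  exists (v, c). rewrite Ex, (ext_iota_gpow c). unfold monomial; cbn [fst snd].
  now rewrite gpow_0, gid_r.
Qed.

Lemma ext_snd_pi_hom : is_hom (fun x => snd (pi x) : Z_grp).
Proof. intros x y. rewrite ext_pi_hom. apply (GammaS_snd_hom det_A). Qed.

Lemma ext_normal_form (x : G) :
  exists n e, x = gpow t3 n ⋅ monomial t1 t2 (iota 1) e.
Proof.
  destruct (ext_monomial_of_snd_pi (gpow t3 (- snd (pi x)) ⋅ x)) as [e E].
  - rewrite ext_snd_pi_hom, (hom_gpow (fun x => snd (pi x) : Z_grp)) by apply ext_snd_pi_hom.
    destruct lifts as (_ & _ & pi3). rewrite pi3. cbn [snd]. rewrite Z_grp_gpow_1.
    apply Z.add_opp_diag_l.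
  - exists (snd (pi x)), e. rewrite <- E, gassoc, <- gpow_add, Z.add_opp_diag_r.
    now rewrite gpow_0, gid_l.
Qed.

Lemma ext_pres_rel_exists : exists q m1 m2, pres_rel A q m1 m2 t1 t2 t3 (iota 1).
Proof.
  destruct lifts as (pi1 & pi2 & pi3).
  destruct (GammaS_pres_rel det_A) as (comm & _ & _ & _ & conj1 & conj2).
  pose proof ext_pi_hom as pi_hom.
  destruct (ext_fiber (gcomm t1 t2) gid) as [q Eq].
  { rewrite (hom_gcomm (pi : G -> GammaS)), (hom_id (pi : G -> GammaS)) by easy.
    now rewrite pi1, pi2. }
  assert (conj_fiber : forall t i j,
    (pi t3 : GammaS) ⋅ pi t ⋅ (pi t3 : GammaS)⁻¹ =
      gpow (pi t1 : GammaS) i ⋅ gpow (pi t2 : GammaS) j ⋅ gpow gid 0 ->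
    exists m, t3 ⋅ t ⋅ t3⁻¹ = gpow t1 i ⋅ gpow t2 j ⋅ iota m).
  { intros t i j E. apply ext_fiber.
    rewrite !pi_hom, !(hom_gpow (pi : G -> GammaS)), (hom_inv (pi : G -> GammaS)) by easy.
    rewrite gpow_0, gid_r in E. exact E. }
  rewrite <- pi1, <- pi2, <- pi3 in conj1, conj2.
  destruct (conj_fiber _ _ _ conj1) as [m1 E1]. destruct (conj_fiber _ _ _ conj2) as [m2 E2].
  rewrite ext_iota_gpow in Eq, E1, E2. rewrite gid_l in Eq.
  exists q, m1, m2. repeat apply conj; try apply ext_iota_central; easy.
Qed.

End CentralExtension.

(** * Classification of the central extensions *)

Lemma monomial_op_central {G : Grp} (t1 t2 tau : G) (a b i j m : Z) : central tau ->
  monomial (t1 ⋅ gpow tau a) (t2 ⋅ gpow tau b) tau (i, j, m) =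
  monomial t1 t2 tau (i, j, a * i + b * j + m).
Proof.
  intros tau_central.
  assert (gpow_central : forall n, central (gpow tau n))
    by (intros n; now apply central_gpow).
  unfold monomial; cbn [fst snd].
  rewrite !gpow_op, !gpow_gpow by apply commute_sym, gpow_central.
  rewrite gop_interchange by apply gpow_central.
  now rewrite <- gassoc, <- !gpow_add.
Qed.

Lemma conj_op_central {G : Grp} (x y z w : G) : central z -> central w ->
  x ⋅ z ⋅ (y ⋅ w) ⋅ (x ⋅ z)⁻¹ = x ⋅ y ⋅ x⁻¹ ⋅ w.
Proof.
  intros z_central w_central. apply conj_eq.
  rewrite gop_interchange, (gop_interchange _ w) by auto.
  now rewrite gopVK, (w_central z).
Qed.

Lemma gcomm_op_central {G : Grp} (x y z w : G) : central z -> central w ->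
  gcomm (x ⋅ z) (y ⋅ w) = gcomm x y.
Proof.
  intros z_central w_central. unfold gcomm. rewrite conj_op_central by easy.
  now rewrite <- gassoc, ginv_op, (gassoc _ w), ginv_r, gid_l.
Qed.

Lemma pres_rel_op_central {A : M2} {q m1 m2 : Z} {G : Grp} {t1 t2 t3 tau : G}
  (a b c : Z) : central tau ->
  pres_rel A q m1 m2 (t1 ⋅ gpow tau a) (t2 ⋅ gpow tau b) (t3 ⋅ gpow tau c) tau <->
  pres_rel A q (m1 + ((m11 A - 1) * a + m21 A * b)) (m2 + (m12 A * a + (m22 A - 1) * b))
    t1 t2 t3 tau.
Proof.
  intros tau_central.
  assert (gpow_central : forall n, central (gpow tau n))
    by (intros n; now apply central_gpow).
  assert (conj_iff : forall t d i j m,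
    t3 ⋅ gpow tau c ⋅ (t ⋅ gpow tau d) ⋅ (t3 ⋅ gpow tau c)⁻¹ =
      monomial (t1 ⋅ gpow tau a) (t2 ⋅ gpow tau b) tau (i, j, m) <->
    t3 ⋅ t ⋅ t3⁻¹ = monomial t1 t2 tau (i, j, a * i + b * j + m - d)).
  { intros t d i j m. rewrite conj_op_central, monomial_op_central by easy.
    unfold monomial; cbn [fst snd].
    replace (a * i + b * j + m) with (a * i + b * j + m - d + d) at 1 by ring.
    rewrite gpow_add, gassoc. split; [apply gcancel_r|congruence]. }
  pose proof (conj_iff t1 a (m11 A) (m21 A) m1) as conj1.
  pose proof (conj_iff t2 b (m12 A) (m22 A) m2) as conj2.
  replace (a * m11 A + b * m21 A + m1 - a) with (m1 + ((m11 A - 1) * a + m21 A * b))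
    in conj1 by ring.
  replace (a * m12 A + b * m22 A + m2 - b) with (m2 + (m12 A * a + (m22 A - 1) * b))
    in conj2 by ring.
  unfold monomial in conj1, conj2; cbn [fst snd] in conj1, conj2.
  unfold pres_rel. rewrite gcomm_op_central, conj1, conj2 by easy.
  split; intros (comm & _ & _ & _ & rel1 & rel2);
    repeat apply conj; try apply tau_central; easy.
Qed.

Lemma pres_rel_unique {A : M2} {q m1 m2 q' m1' m2' : Z} {G : Grp} {t1 t2 t3 tau : G} :
  Injective (gpow tau) -> pres_rel A q m1 m2 t1 t2 t3 tau ->
  pres_rel A q' m1' m2' t1 t2 t3 tau -> q = q' /\ m1 = m1' /\ m2 = m2'.
Proof.
  intros tau_inj (comm & _ & _ & _ & rel1 & rel2) (comm' & _ & _ & _ & rel1' & rel2').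
  rewrite comm in comm'. rewrite rel1 in rel1'. rewrite rel2 in rel2'.
  apply gcancel_l in rel1', rel2'. auto.
Qed.

Definition is_ext_morphism {A : M2} (E1 E2 : CExt A) (phi : cx_grp E1 -> cx_grp E2) : Prop :=
  is_hom phi /\ (forall n, phi (cx_iota E1 n) = cx_iota E2 n) /\
  (forall x, cx_pi E2 (phi x) = cx_pi E1 x).

Lemma ext_morphism_bijective {A : M2} (det_A : M2det A = 1) (E1 E2 : CExt A)
  (phi : cx_grp E1 -> cx_grp E2) :
  is_ext_morphism E1 E2 phi -> Injective phi /\ Surjective phi.
Proof.
  destruct E1 as [G1 iota1 pi1 ext1], E2 as [G2 iota2 pi2 ext2].
  unfold is_ext_morphism; simpl in *. intros (phi_hom & phi_iota & phi_pi). split.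
  - apply hom_injective; [easy|]. intros x Ex.
    assert (Epi : pi1 x = GammaS_id).
    { rewrite <- phi_pi, Ex, <- (ext_iota_0 ext2). apply (ext_pi_iota ext2). }
    apply ext1 in Epi. destruct Epi as [n ->].
    rewrite phi_iota, <- (ext_iota_0 ext2) in Ex.
    apply (ext_iota_injective ext2) in Ex. subst n.
    apply (ext_iota_0 ext1).
  - intros y. destruct (ext_pi_surjective ext1 (pi2 y)) as [x Ex].
    destruct (ext_fiber det_A ext2 y (phi x)) as [n En]; [now rewrite phi_pi|].
    exists (x ⋅ iota1 n). now rewrite phi_hom, phi_iota.
Qed.

Lemma ext_equiv_sym {A : M2} (det_A : M2det A = 1) (E1 E2 : CExt A) :
  ext_equiv E1 E2 -> ext_equiv E2 E1.
Proof.
  intros (phi & phi_morph).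
  destruct (ext_morphism_bijective det_A E1 E2 phi phi_morph) as [phi_inj phi_surj].
  destruct phi_morph as (phi_hom & phi_iota & phi_pi).
  destruct (inverse_homs_of_bijection phi phi_hom phi_inj phi_surj)
    as (psi & _ & psi_hom & psi_phi & phi_psi).
  exists psi. repeat split; [easy| |].
  - intros n. now rewrite <- phi_iota, psi_phi.
  - intros y. now rewrite <- phi_pi, phi_psi.
Qed.

Lemma ext_equiv_trans {A : M2} (E1 E2 E3 : CExt A) :
  ext_equiv E1 E2 -> ext_equiv E2 E3 -> ext_equiv E1 E3.
Proof.
  intros (phi & phi_hom & phi_iota & phi_pi) (psi & psi_hom & psi_iota & psi_pi).
  exists (fun x => psi (phi x)). repeat split.
  - intros x y. now rewrite phi_hom, psi_hom.
  - intros n. now rewrite phi_iota, psi_iota.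
  - intros x. now rewrite psi_pi, phi_pi.
Qed.

Definition has_invariants {A : M2} (E : CExt A) (q : Z) (v : Z * Z) : Prop :=
  exists t1 t2 t3, lifts_basis (cx_pi E) t1 t2 t3 /\
    pres_rel A q (fst v) (snd v) t1 t2 t3 (cx_iota E 1).

Definition tGamma_ext {A : M2} (det_A : M2det A = 1) (q : Z) (v : Z * Z) : CExt A :=
  mkCExt A _ _ _ (tGamma_central_ext det_A q (fst v) (snd v)).

Section Classification.

Context {A : M2} (det_A : M2det A = 1).

Lemma has_invariants_exists (E : CExt A) : exists qv, has_invariants E (fst qv) (snd qv).
Proof.
  pose proof (ext_pi_surjective (cx_ok _ E)) as pi_surj.
  destruct (pi_surj (1, 0, 0)) as [t1 pi1], (pi_surj (0, 1, 0)) as [t2 pi2],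
    (pi_surj (0, 0, 1)) as [t3 pi3].
  assert (lifts : lifts_basis (cx_pi E) t1 t2 t3) by easy.
  destruct (ext_pres_rel_exists det_A (cx_ok _ E) lifts) as (q & m1 & m2 & rel).
  now exists (q, (m1, m2)), t1, t2, t3.
Qed.

Lemma has_invariants_iff_coker_eq (E : CExt A) (q q' : Z) (v w : Z * Z) :
  has_invariants E q v -> has_invariants E q' w <-> q = q' /\ coker_eq A v w.
Proof.
  destruct E as [G iota pi ext], v as [m1 m2], w as [m1' m2'].
  intros (t1 & t2 & t3 & (pi1 & pi2 & pi3) & rel); cbn [cx_pi cx_iota cx_grp fst snd] in *.
  pose proof (ext_iota_central ext 1) as tau_central.
  assert (iota_gpow : forall n, iota n = gpow (iota 1) n) by apply (ext_iota_gpow ext).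
  assert (tau_inj : Injective (gpow (iota 1))).
  { intros m n. rewrite <- !iota_gpow. apply (ext_iota_injective ext). }
  split.
  - intros (s1 & s2 & s3 & (pi1' & pi2' & pi3') & rel').
    cbn [cx_pi cx_iota cx_grp fst snd] in *.
    destruct (ext_fiber det_A ext s1 t1) as [a ->]; [congruence|].
    destruct (ext_fiber det_A ext s2 t2) as [b ->]; [congruence|].
    destruct (ext_fiber det_A ext s3 t3) as [c ->]; [congruence|].
    rewrite (iota_gpow a), (iota_gpow b), (iota_gpow c), pres_rel_op_central in rel' by easy.
    destruct (pres_rel_unique tau_inj rel rel') as (-> & Em1 & Em2).
    split; [easy|]. exists a, b. cbn [fst snd]. lia.
  - intros (<- & a & b & Em1 & Em2); cbn [fst snd] in *.
    exists (t1 ⋅ gpow (iota 1) a), (t2 ⋅ gpow (iota 1) b), (t3 ⋅ gpow (iota 1) 0).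
    cbn [cx_pi cx_iota cx_grp fst snd]. split.
    + unfold lifts_basis. rewrite <- !iota_gpow. now rewrite !(ext_pi_op_iota det_A ext).
    + apply pres_rel_op_central; [easy|]. rewrite <- Em1, <- Em2.
      now rewrite !Zplus_minus.
Qed.

Lemma has_invariants_tGamma_ext (q : Z) (v : Z * Z) :
  has_invariants (tGamma_ext det_A q v) q v.
Proof.
  exists (tGamma_t1 det_A q (fst v) (snd v)), (tGamma_t2 det_A q (fst v) (snd v)),
    (tGamma_t3 det_A q (fst v) (snd v)).
  split; [easy|]. unfold tGamma_ext; cbn [cx_iota cx_grp].
  rewrite gpow_1. apply tGamma_pres_rel.
Qed.

Lemma has_invariants_ext_equiv (E1 E2 : CExt A) (q : Z) (v : Z * Z) :
  ext_equiv E1 E2 -> has_invariants E1 q v -> has_invariants E2 q v.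
Proof.
  intros (phi & phi_hom & phi_iota & phi_pi) (t1 & t2 & t3 & lifts & rel).
  exists (phi t1), (phi t2), (phi t3). unfold lifts_basis. rewrite !phi_pi. split; [easy|].
  rewrite <- phi_iota. now apply hom_pres_rel.
Qed.

Lemma tGamma_ext_equiv (E : CExt A) (q : Z) (v : Z * Z) :
  has_invariants E q v -> ext_equiv (tGamma_ext det_A q v) E.
Proof.
  intros (t1 & t2 & t3 & (pi1 & pi2 & pi3) & rel).
  pose proof (tGamma_presented det_A q (fst v) (snd v)) as pres.
  destruct (proj1 (proj2 pres _ _ _ _ _ rel))
    as (phi & phi_hom & phi1 & phi2 & phi3 & phi_tau).
  exists phi. repeat split; [easy| |].
  - intros n. cbn. rewrite (hom_gpow phi), phi_tau by easy.
    symmetry. apply (ext_iota_gpow (cx_ok _ E)).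
  - pose proof (ext_pi_hom det_A (cx_ok _ E)) as pi_hom.
    apply (presented_hom_ext (fun x => cx_pi E (phi x) : GammaS_grp A det_A)
             (tGamma_pi det_A q (fst v) (snd v)) pres).
    + intros x y. now rewrite phi_hom, pi_hom.
    + exact (ext_pi_hom det_A (tGamma_central_ext det_A q (fst v) (snd v))).
    + now rewrite phi1.
    + now rewrite phi2.
    + now rewrite phi3.
    + rewrite phi_tau. apply (ext_pi_iota (cx_ok _ E)).
Qed.

Lemma ext_equiv_iff_invariants (E1 E2 : CExt A) (q1 q2 : Z) (v1 v2 : Z * Z) :
  has_invariants E1 q1 v1 -> has_invariants E2 q2 v2 ->
  ext_equiv E1 E2 <-> q1 = q2 /\ coker_eq A v1 v2.
Proof.
  intros inv1 inv2. rewrite <- (has_invariants_iff_coker_eq E1) by easy. split.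
  - intros E12. apply (has_invariants_ext_equiv E2); [now apply ext_equiv_sym|easy].
  - intros inv1'. apply (ext_equiv_trans _ (tGamma_ext det_A q2 v2)).
    + now apply ext_equiv_sym, tGamma_ext_equiv.
    + now apply tGamma_ext_equiv.
Qed.

End Classification.

(** * Hyperbolic integer matrices *)

Open Scope R_scope.

Definition left_eigenvector (A : M2) (l x1 x2 : R) : Prop :=
  IZR (m11 A) * x1 + IZR (m21 A) * x2 = l * x1 /\
  IZR (m12 A) * x1 + IZR (m22 A) * x2 = l * x2.

Definition lform (x1 x2 : R) (v : Z * Z) : R := IZR (fst v) * x1 + IZR (snd v) * x2.

Lemma lform_M2app (A : M2) (l x1 x2 : R) (v : Z * Z) :
  left_eigenvector A l x1 x2 -> lform x1 x2 (M2app A v) = l * lform x1 x2 v.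
Proof.
  intros [E1 E2]. unfold lform, M2app; cbn [fst snd]. rewrite !plus_IZR, !mult_IZR.
  transitivity (IZR (fst v) * (l * x1) + IZR (snd v) * (l * x2)); [|ring].
  rewrite <- E1, <- E2. ring.
Qed.

Lemma lform_M2app_pow (A : M2) (s x1 x2 : R) (n : Z) (v : Z * Z) : M2det A = 1%Z ->
  left_eigenvector A (exp s) x1 x2 ->
  lform x1 x2 (M2app (M2pow A n) v) = exp (IZR n * s) * lform x1 x2 v.
Proof.
  intros det_A eigen. Z_induction n.
  - cbn [M2pow]. now rewrite M2app_id, Rmult_0_l, exp_0, Rmult_1_l.
  - rewrite M2app_pow_succ, (lform_M2app A (exp s)) by easy.
    rewrite plus_IZR, Rmult_plus_distr_r, Rmult_1_l, Rplus_comm, exp_plus, Rmult_assoc.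
    split; intros E; [now rewrite E|].
    apply Rmult_eq_reg_l in E; [easy|]. apply Rgt_not_eq, exp_pos.
Qed.

Lemma left_eigenvector_of_char_root (A : M2) (l : R) : M2det A = 1%Z ->
  l * l = IZR (M2tr A) * l - 1 -> left_eigenvector A l (IZR (m21 A)) (l - IZR (m11 A)).
Proof.
  unfold M2det, M2tr. intros det_A root. apply (f_equal IZR) in det_A.
  rewrite minus_IZR, !mult_IZR in det_A. rewrite plus_IZR in root. split; [ring|nra].
Qed.

Lemma exp_add_exp_opp_surj (t : R) : 2 < t -> exists u, 0 < u /\ exp u + exp (- u) = t.
Proof.
  intros t_gt2. set (s := sqrt (t * t - 4)).
  assert (s_sq : s * s = t * t - 4) by (apply sqrt_sqrt; nra).
  assert (s_ge0 : 0 <= s) by apply sqrt_pos.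
  set (l := (t + s) / 2). assert (l_gt1 : 1 < l) by (unfold l; lra).
  assert (root : l * l = t * l - 1) by (unfold l; nra).
  exists (ln l). split.
  - rewrite <- ln_1. apply ln_increasing; lra.
  - rewrite exp_Ropp, exp_ln by lra.
    apply (Rmult_eq_reg_r l); [|lra]. rewrite Rmult_plus_distr_r, Rinv_l by lra. lra.
Qed.

Lemma m21_neq0 (A : M2) : M2det A = 1%Z -> (M2tr A > 2)%Z -> m21 A <> 0%Z.
Proof.
  unfold M2det, M2tr. intros det_A tr_A E. rewrite E in det_A.
  assert (E' : (m11 A * m22 A = 1)%Z) by lia.
  destruct (Z.mul_eq_1 _ _ E') as [E1|E1]; rewrite E1 in *; lia.
Qed.

Lemma exp_opp_mul (r : R) : exp (- r) * exp r = 1.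
Proof. now rewrite <- exp_plus, Rplus_opp_l, exp_0. Qed.

Lemma hyperbolic_eigenbasis (A : M2) : M2det A = 1%Z -> (M2tr A > 2)%Z ->
  exists u x1 x2 y1 y2, 0 < u /\ x1 * y2 - x2 * y1 <> 0 /\
    left_eigenvector A (exp (- u)) x1 x2 /\ left_eigenvector A (exp u) y1 y2.
Proof.
  intros det_A tr_A. pose proof (m21_neq0 A det_A tr_A) as m21_neq0.
  apply Z.gt_lt, IZR_lt in tr_A. apply not_0_IZR in m21_neq0.
  destruct (exp_add_exp_opp_surj _ tr_A) as (u & u_pos & tr_eq).
  pose proof (exp_opp_mul u) as prod_eq.
  assert (exp_lt : exp (- u) < exp u) by (apply exp_increasing; lra).
  exists u, (IZR (m21 A)), (exp (- u) - IZR (m11 A)), (IZR (m21 A)), (exp u - IZR (m11 A)).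
  split; [easy|]. split; [|split].
  - replace (_ - _) with (IZR (m21 A) * (exp u - exp (- u))) by ring.
    apply Rmult_integral_contrapositive. split; [easy|lra].
  - apply left_eigenvector_of_char_root; [easy|]. rewrite <- tr_eq. lra.
  - apply left_eigenvector_of_char_root; [easy|]. rewrite <- tr_eq. lra.
Qed.

Lemma IZR_mul_small (a : Z) (d : R) : Rabs (IZR a * d) < Rabs d -> a = 0%Z.
Proof.
  intros small. destruct (Z.eq_dec a 0) as [|a_neq0]; [easy|exfalso].
  rewrite Rabs_mult, Rabs_Zabs in small.
  assert (1 <= IZR (Z.abs a)) by (apply IZR_le; lia).
  pose proof (Rabs_pos d). nra.
Qed.

Lemma lform_discrete (x1 x2 y1 y2 : R) : x1 * y2 - x2 * y1 <> 0 ->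
  exists eps, 0 < eps /\ forall v,
    Rabs (lform x1 x2 v) < eps -> Rabs (lform y1 y2 v) < eps -> v = (0, 0)%Z.
Proof.
  set (d := x1 * y2 - x2 * y1). intros d_neq0.
  set (K := 1 + Rabs x1 + Rabs x2 + Rabs y1 + Rabs y2).
  pose proof (Rabs_pos x1). pose proof (Rabs_pos x2).
  pose proof (Rabs_pos y1). pose proof (Rabs_pos y2).
  assert (K_pos : 0 < K) by (unfold K; lra).
  assert (d_pos : 0 < Rabs d) by now apply Rabs_pos_lt.
  exists (Rabs d / K). split; [now apply Rdiv_lt_0_compat|].
  intros [a b]. unfold lform; cbn [fst snd].
  set (X := IZR a * x1 + IZR b * x2). set (Y := IZR a * y1 + IZR b * y2).
  intros X_small Y_small.
  assert (comb_small : forall r s, Rabs r + Rabs s < K -> Rabs (X * r - Y * s) < Rabs d).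
  { intros r s rs_lt. eapply Rle_lt_trans; [apply Rabs_triang|].
    rewrite Rabs_Ropp, !Rabs_mult. replace (Rabs d) with (Rabs d / K * K) by (field; lra).
    pose proof (Rabs_pos r). pose proof (Rabs_pos s).
    pose proof (Rabs_pos X). pose proof (Rabs_pos Y). nra. }
  assert (a = 0%Z) as ->.
  { apply (IZR_mul_small a d). replace (IZR a * d) with (X * y2 - Y * x2)
      by (unfold X, Y, d; ring). apply comb_small. unfold K; lra. }
  assert (b = 0%Z) as ->; [|easy].
  apply (IZR_mul_small b d). replace (IZR b * d) with (- (X * y1 - Y * x1))
    by (unfold X, Y, d; ring). rewrite Rabs_Ropp. apply comb_small. unfold K; lra.
Qed.

Lemma M2app_pow_fixed (A : M2) (n : Z) (v : Z * Z) :
  M2det A = 1%Z -> (M2tr A > 2)%Z -> n <> 0%Z -> M2app (M2pow A n) v = v -> v = (0, 0)%Z.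
Proof.
  intros det_A tr_A n_neq0 fixed. apply not_0_IZR in n_neq0.
  destruct (hyperbolic_eigenbasis A det_A tr_A)
    as (u & x1 & x2 & y1 & y2 & u_pos & d_neq0 & x_eigen & y_eigen).
  assert (lform_0 : forall s z1 z2, s <> 0 -> left_eigenvector A (exp s) z1 z2 ->
            lform z1 z2 v = 0).
  { intros s z1 z2 s_neq0 eigen.
    pose proof (lform_M2app_pow A s z1 z2 n v det_A eigen) as E. rewrite fixed in E.
    destruct (Req_dec (lform z1 z2 v) 0) as [|lform_neq0]; [easy|exfalso].
    assert (ns_eq0 : IZR n * s = 0).
    { apply exp_inv. rewrite exp_0. apply (Rmult_eq_reg_r (lform z1 z2 v)); lra. }
    apply Rmult_integral in ns_eq0. tauto. }
  destruct (lform_discrete x1 x2 y1 y2 d_neq0) as (eps & eps_pos & discrete).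
  apply discrete.
  - rewrite (lform_0 (- u) x1 x2), Rabs_R0 by (easy || lra). easy.
  - rewrite (lform_0 u y1 y2), Rabs_R0 by (easy || lra). easy.
Qed.

Close Scope R_scope.

(** * Solvability and the nilradical *)

Lemma gen_incl {G : Grp} (A : G -> Prop) (x : G) : A x -> gen A x.
Proof. intros Ax K _ AK. now apply AK. Qed.

Lemma nilpotent_normal_engel {G : Grp} (M : G -> Prop) (x : G) :
  is_normal M -> nilpotent_sub M -> M x ->
  exists k, forall y, Nat.iter k (gcomm x) y = gid.
Proof.
  intros [(_ & M_op & M_inv) M_conj] [k M_lcs] Mx. exists (S k). intros y. apply M_lcs.
  clear M_lcs. induction k as [|k IH].
  - simpl. unfold gcomm. rewrite <- !gassoc, (gassoc _ y). auto.
  - rewrite Nat.iter_succ. apply gen_incl. now exists x, (Nat.iter (S k) (gcomm x) y).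
Qed.

Lemma GammaS_engel {A : M2} (det_A : M2det A = 1) (x : GammaS_grp A det_A)
  (v : Z * Z) (k : nat) :
  M2tr A > 2 -> v <> (0, 0) ->
  Nat.iter k (gcomm x) ((v, 0) : GammaS_grp A det_A) = gid -> snd x = 0.
Proof.
  intros tr_A v_neq0 engel. destruct x as [w n]; cbn [snd].
  destruct (Z.eq_dec n 0) as [|n_neq0]; [easy|exfalso].
  assert (iter_neq0 : exists v', v' <> (0, 0) /\
    Nat.iter k (gcomm ((w, n) : GammaS_grp A det_A)) (v, 0) = (v', 0)).
  { clear engel. induction k as [|k (v' & v'_neq0 & IH)]; [now exists v|].
    rewrite Nat.iter_succ, IH, GammaS_gcomm_translation. eexists. split; [|easy].
    intros E. apply v'_neq0, (M2app_pow_fixed A n); try easy.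
    apply (gcancel_r (vopp v' : Z2_grp)). transitivity ((0, 0) : Z2_grp); [exact E|].
    symmetry. apply (ginv_r (v' : Z2_grp)). }
  destruct iter_neq0 as (v' & v'_neq0 & E). rewrite E in engel. now injection engel.
Qed.

Section SolvabilityAndNilradical.

Context {A : M2} (det_A : M2det A = 1) {G : Grp} {iota : Z -> G} {pi : G -> Z * Z * Z}
  (ext : is_central_ext A G iota pi).

Notation GammaS := (GammaS_grp A det_A).

Lemma ext_snd_pi_gcomm (x y : G) : snd (pi (gcomm x y)) = 0.
Proof.
  rewrite (hom_gcomm (fun x => snd (pi x) : Z_grp)) by apply (ext_snd_pi_hom det_A ext).
  apply (gcomm_commute (G := Z_grp)), Z.add_comm.
Qed.

Lemma ext_pi_gcomm (x y : G) :
  snd (pi x) = 0 -> snd (pi y) = 0 -> pi (gcomm x y) = GammaS_id.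
Proof.
  rewrite (hom_gcomm (pi : G -> GammaS)) by apply (ext_pi_hom det_A ext).
  destruct (pi x) as [v m], (pi y) as [w n]. cbn [snd]. intros -> ->.
  apply (gcomm_commute (G := GammaS)), GammaS_translation_commute.
Qed.

Lemma ext_gcomm_ker (x y : G) : pi y = GammaS_id -> gcomm x y = gid.
Proof.
  intros ker. apply ext in ker. destruct ker as [n ->].
  apply gcomm_commute, commute_sym, (ext_iota_central ext).
Qed.

Lemma ext_solvable : solvable G.
Proof.
  exists 3%nat.
  assert (derived1 : forall x, derived G 1 x -> snd (pi x) = 0).
  { apply commsub_incl; [apply (kernel_subgroup _ (ext_snd_pi_hom det_A ext))|].
    intros x y _ _. apply ext_snd_pi_gcomm. }
  assert (derived2 : forall x, derived G 2 x -> pi x = GammaS_id).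
  { apply commsub_incl; [apply (kernel_subgroup _ (ext_pi_hom det_A ext))|].
    intros x y Dx Dy. apply ext_pi_gcomm; now apply derived1. }
  apply commsub_incl; [now apply (kernel_subgroup (fun x : G => x))|].
  intros x y _ Dy. apply ext_gcomm_ker. now apply derived2.
Qed.

Context {t1 t2 t3 : G} (lifts : lifts_basis pi t1 t2 t3).

Lemma ext_gen_heis_iff (x : G) :
  gen (fun x => x = t1 \/ x = t2 \/ x = iota 1) x <-> snd (pi x) = 0.
Proof.
  split.
  - intros gen_x. apply gen_x; [apply (kernel_subgroup _ (ext_snd_pi_hom det_A ext))|].
    destruct lifts as (pi1 & pi2 & _).
    intros y [->|[->| ->]]; [now rewrite pi1|now rewrite pi2|].
    now rewrite (ext_pi_iota ext).
  - intros E. destruct (ext_monomial_of_snd_pi det_A ext lifts x E) as [e ->].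
    pose proof (gen_subgroup (fun x => x = t1 \/ x = t2 \/ x = iota 1)) as gen_sub.
    apply gen_sub; [apply gen_sub|]; apply subgroup_gpow; try easy; apply gen_incl; auto.
Qed.

Lemma ext_nilradical : M2tr A > 2 ->
  is_nilradical (gen (fun x => x = t1 \/ x = t2 \/ x = iota 1)).
Proof.
  intros tr_A. pose proof ext_gen_heis_iff as gen_iff. set (N := gen _) in *.
  split; [split; [apply gen_subgroup|]|split].
  - intros x y. rewrite !gen_iff. intros Ey.
    rewrite !(ext_snd_pi_hom det_A ext), Ey, (hom_inv (fun x => snd (pi x) : Z_grp))
      by apply (ext_snd_pi_hom det_A ext).
    cbn. lia.
  - exists 2%nat.
    assert (lcs1 : forall x, lcs N 1 x -> pi x = GammaS_id).
    { apply commsub_incl; [apply (kernel_subgroup _ (ext_pi_hom det_A ext))|].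
      intros x y Nx Ny. apply ext_pi_gcomm; now apply gen_iff. }
    apply commsub_incl; [now apply (kernel_subgroup (fun x : G => x))|].
    intros x y _ Ly. apply ext_gcomm_ker. now apply lcs1.
  - intros M M_normal M_nilp x Mx. apply gen_iff.
    destruct (nilpotent_normal_engel M x M_normal M_nilp Mx) as [k engel].
    apply (GammaS_engel det_A (pi x) (1, 0) k); [easy..|].
    destruct lifts as (pi1 & _). rewrite <- pi1.
    rewrite <- (Nat.iter_swap_gen _ _ (pi : G -> GammaS) (gcomm x)).
    + rewrite engel. apply (hom_id (pi : G -> GammaS)), (ext_pi_hom det_A ext).
    + intros y. apply (hom_gcomm (pi : G -> GammaS)), (ext_pi_hom det_A ext).
Qed.

End SolvabilityAndNilradical.

(** * Lattices in Sol_1^4 *)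

Open Scope R_scope.

Definition sol_grp : Grp.
Proof.
  refine (Build_Grp R4
    (fun g h => let '(x, y, z, u) := g in let '(x', y', z', u') := h in
                (x' + x * exp u', y + exp u * y', z + z' + x * y', u + u'))
    (0, 0, 0, 0)
    (fun g => let '(x, y, z, u) := g in
              (- x * exp (- u), - exp (- u) * y, - z + x * exp (- u) * y, - u)) _ _ _).
  - intros [[[x y] z] u] [[[x' y'] z'] u'] [[[x'' y''] z''] u''].
    rewrite !exp_plus. coordwise; ring.
  - intros [[[x y] z] u]. rewrite exp_0. coordwise; ring.
  - intros [[[x y] z] u]. pose proof (exp_opp_mul u) as E.
    coordwise; try ring.
    transitivity (x - x * (exp (- u) * exp u)); [ring|]. rewrite E. ring.
Defined.

Lemma sol_mx_op (g h : sol_grp) : mx3_eq (sol_mx (g ⋅ h)) (mmul3 (sol_mx g) (sol_mx h)).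
Proof.
  destruct g as [[[x y] z] u], h as [[[x' y'] z'] u'].
  intros i j i_lt j_lt. unfold mmul3.
  destruct i as [|[|[|i]]]; [..|lia]; destruct j as [|[|[|j]]]; try lia; cbn;
    rewrite ?exp_plus; ring.
Qed.

Definition sol_diag (u : R) : sol_grp := (0, 0, 0, u).

(* Logarithmic coordinates on the Heisenberg subgroup [u = 0], in which powers are linear. *)
Definition sol_unip (x y w : R) : sol_grp := (x, y, w + x * y / 2, 0).

Ltac sol_ring :=
  unfold sol_unip, sol_diag; cbn [gop gid sol_grp]; rewrite ?exp_0;
  coordwise; field.

Lemma sol_unip_op (x y w x' y' w' : R) :
  sol_unip x y w ⋅ sol_unip x' y' w' =
  sol_unip (x + x') (y + y') (w + w' + (x * y' - x' * y) / 2).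
Proof. sol_ring. Qed.

Lemma sol_diag_op_unip (u x y w : R) :
  sol_diag u ⋅ sol_unip x y w = (x, exp u * y, w + x * y / 2, u).
Proof. sol_ring. Qed.

Lemma sol_unip_op_diag (x y w u : R) :
  sol_unip x y w ⋅ sol_diag u = (x * exp u, y, w + x * y / 2, u).
Proof. sol_ring. Qed.

Lemma sol_diag_conj (u x y w : R) :
  sol_diag u ⋅ sol_unip x y w = sol_unip (exp (- u) * x) (exp u * y) w ⋅ sol_diag u.
Proof.
  rewrite sol_diag_op_unip, sol_unip_op_diag. pose proof (exp_opp_mul u) as E.
  coordwise; try easy.
  - transitivity (x * (exp (- u) * exp u)); [rewrite E; ring|ring].
  - transitivity (w + (exp (- u) * exp u) * (x * y) / 2); [rewrite E|]; field.
Qed.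

Lemma sol_factorization (x y w s r : R) :
  ((x, y, w, s + r) : sol_grp) =
  sol_diag s ⋅
  sol_unip (x * exp (- r)) (exp (- s) * y) (w - x * exp (- r) * (exp (- s) * y) / 2) ⋅
  sol_diag r.
Proof.
  pose proof (exp_opp_mul s) as Es. pose proof (exp_opp_mul r) as Er.
  rewrite sol_diag_op_unip. unfold sol_diag; cbn [gop sol_grp].
  coordwise.
  - transitivity (x * (exp (- r) * exp r)); [rewrite Er|]; ring.
  - transitivity (exp (- s) * exp s * y); [rewrite Es|]; ring.
  - field.
  - ring.
Qed.

Lemma sol_unip_central (w : R) (x y w' : R) : commute (sol_unip 0 0 w) (sol_unip x y w').
Proof. unfold commute. sol_ring. Qed.

Lemma sol_unip_gcomm (x y w x' y' w' : R) :
  gcomm (sol_unip x y w) (sol_unip x' y' w') = sol_unip 0 0 (x * y' - x' * y).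
Proof. apply gcomm_unique. sol_ring. Qed.

Lemma sol_unip_gpow (x y w : R) (n : Z) :
  gpow (sol_unip x y w) n = sol_unip (IZR n * x) (IZR n * y) (IZR n * w).
Proof.
  symmetry. transitivity (gpow (sol_unip (1 * x) (1 * y) (1 * w)) n);
    [|now rewrite !Rmult_1_l].
  apply (gpow_unique (fun n => sol_unip (IZR n * x) (IZR n * y) (IZR n * w))).
  intros a b. rewrite sol_unip_op, plus_IZR. f_equal; field.
Qed.

Lemma sol_diag_gpow (u : R) (n : Z) : gpow (sol_diag u) n = sol_diag (IZR n * u).
Proof.
  symmetry. transitivity (gpow (sol_diag (1 * u)) n); [|now rewrite Rmult_1_l].
  apply (gpow_unique (fun n => sol_diag (IZR n * u))).
  intros a b. rewrite plus_IZR. sol_ring.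
Qed.

Lemma sol_monomial (x1 x2 y1 y2 w1 w2 z : R) (v : Z * Z) (c : Z) :
  monomial (sol_unip x1 y1 w1) (sol_unip x2 y2 w2) (sol_unip 0 0 z) (v, c) =
  sol_unip (lform x1 x2 v) (lform y1 y2 v)
    (lform w1 w2 v + IZR (fst v) * IZR (snd v) * ((x1 * y2 - x2 * y1) / 2) + IZR c * z).
Proof.
  unfold monomial, lform; cbn [fst snd]. rewrite !sol_unip_gpow, !sol_unip_op.
  f_equal; field.
Qed.

Lemma linear_system2 (a b c d r s : R) :
  a * d - b * c <> 0 -> exists x y, a * x + b * y = r /\ c * x + d * y = s.
Proof.
  intros det_neq0.
  exists ((r * d - b * s) / (a * d - b * c)), ((a * s - c * r) / (a * d - b * c)).
  split; now field.
Qed.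

Lemma sol_pres_rel (A : M2) (q m1 m2 : Z) (u x1 x2 y1 y2 w1 w2 z : R) :
  let d := x1 * y2 - x2 * y1 in
  left_eigenvector A (exp (- u)) x1 x2 -> left_eigenvector A (exp u) y1 y2 ->
  d = IZR q * z ->
  lform w1 w2 (m11 A, m21 A) + IZR (m11 A) * IZR (m21 A) * (d / 2) + IZR m1 * z = w1 ->
  lform w1 w2 (m12 A, m22 A) + IZR (m12 A) * IZR (m22 A) * (d / 2) + IZR m2 * z = w2 ->
  pres_rel A q m1 m2 (sol_unip x1 y1 w1) (sol_unip x2 y2 w2) (sol_diag u) (sol_unip 0 0 z).
Proof.
  intros d [x_eigen1 x_eigen2] [y_eigen1 y_eigen2] d_eq w1_eq w2_eq.
  assert (conj_monomial : forall x y w i j m,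
    lform x1 x2 (i, j) = exp (- u) * x -> lform y1 y2 (i, j) = exp u * y ->
    lform w1 w2 (i, j) + IZR i * IZR j * (d / 2) + IZR m * z = w ->
    sol_diag u ⋅ sol_unip x y w ⋅ (sol_diag u)⁻¹ =
      monomial (sol_unip x1 y1 w1) (sol_unip x2 y2 w2) (sol_unip 0 0 z) (i, j, m)).
  { intros x y w i j m Ex Ey <-. apply conj_eq.
    now rewrite sol_diag_conj, sol_monomial, Ex, Ey. }
  repeat apply conj; try apply sol_unip_central.
  - rewrite sol_unip_gcomm, sol_unip_gpow. fold d. f_equal; [ring..|exact d_eq].
  - sol_ring.
  - now apply conj_monomial.
  - now apply conj_monomial.
Qed.

Lemma sol_pres_rel_exists (A : M2) (q m1 m2 : Z) :
  M2det A = 1%Z -> (M2tr A > 2)%Z -> q <> 0%Z ->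
  exists u x1 x2 y1 y2 w1 w2 z, 0 < u /\ x1 * y2 - x2 * y1 <> 0 /\ z <> 0 /\
    pres_rel A q m1 m2 (sol_unip x1 y1 w1) (sol_unip x2 y2 w2) (sol_diag u) (sol_unip 0 0 z).
Proof.
  intros det_A tr_A q_neq0. apply not_0_IZR in q_neq0.
  destruct (hyperbolic_eigenbasis A det_A tr_A)
    as (u & x1 & x2 & y1 & y2 & u_pos & d_neq0 & x_eigen & y_eigen).
  set (d := x1 * y2 - x2 * y1) in *. set (z := d / IZR q).
  assert (z_neq0 : z <> 0).
  { apply Rmult_integral_contrapositive. split; [easy|]. now apply Rinv_neq_0_compat. }
  destruct (linear_system2 (IZR (m11 A) - 1) (IZR (m21 A)) (IZR (m12 A)) (IZR (m22 A) - 1)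
    (- (IZR (m11 A) * IZR (m21 A) * (d / 2) + IZR m1 * z))
    (- (IZR (m12 A) * IZR (m22 A) * (d / 2) + IZR m2 * z))) as (w1 & w2 & w1_eq & w2_eq).
  { unfold M2det in det_A. apply (f_equal IZR) in det_A. rewrite minus_IZR, !mult_IZR in det_A.
    unfold M2tr in tr_A. apply Z.gt_lt, IZR_lt in tr_A. rewrite plus_IZR in tr_A. nra. }
  exists u, x1, x2, y1, y2, w1, w2, z. repeat (split; [easy|]).
  apply sol_pres_rel; try easy; fold d; unfold lform; cbn [fst snd].
  - unfold z. now field.
  - lra.
  - lra.
Qed.

Lemma IZR_mul_cobounded (d r : R) : d <> 0 -> exists n, Rabs (r - IZR n * d) <= Rabs d.
Proof.
  intros d_neq0. exists (up (r / d) - 1)%Z. rewrite minus_IZR.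
  pose proof (archimed (r / d)) as bounds. pose proof (Rabs_pos d).
  replace (r - _) with ((r / d - (IZR (up (r / d)) - 1)) * d) by now field.
  rewrite Rabs_mult, Rabs_pos_eq by lra. nra.
Qed.

Lemma lform_cobounded (x1 x2 y1 y2 x y : R) : x1 * y2 - x2 * y1 <> 0 ->
  exists v, Rabs (x - lform x1 x2 v) <= Rabs x1 + Rabs x2 /\
            Rabs (y - lform y1 y2 v) <= Rabs y1 + Rabs y2.
Proof.
  intros d_neq0. destruct (linear_system2 x1 x2 y1 y2 x y d_neq0) as (a & b & <- & <-).
  destruct (IZR_mul_cobounded 1 a) as [m am]; [lra|].
  destruct (IZR_mul_cobounded 1 b) as [n bn]; [lra|].
  rewrite Rmult_1_r, Rabs_R1 in am, bn. exists (m, n).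
  assert (bound : forall r s, Rabs (r * a + s * b - lform r s (m, n)) <= Rabs r + Rabs s).
  { intros r s. unfold lform; cbn [fst snd].
    replace (_ - _) with (r * (a - IZR m) + s * (b - IZR n)) by ring.
    eapply Rle_trans; [apply Rabs_triang|]. rewrite !Rabs_mult.
    pose proof (Rabs_pos r). pose proof (Rabs_pos s). nra. }
  split; apply bound.
Qed.

Section SolLattice.

Variables u x1 x2 y1 y2 w1 w2 z : R.
Hypotheses (u_pos : 0 < u) (d_neq0 : x1 * y2 - x2 * y1 <> 0) (z_neq0 : z <> 0).

Notation unip_monomial :=
  (monomial (sol_unip x1 y1 w1) (sol_unip x2 y2 w2) (sol_unip 0 0 z)).

Lemma sol_lattice_discrete : exists eps, 0 < eps /\ forall n e,
  R4_small eps (gpow (sol_diag u) n ⋅ unip_monomial e) -> n = 0%Z /\ e = (0, 0, 0)%Z.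
Proof.
  destruct (lform_discrete x1 x2 y1 y2 d_neq0) as (eps & eps_pos & discrete).
  assert (z_pos : 0 < Rabs z) by now apply Rabs_pos_lt.
  exists (Rmin eps (Rmin u (Rabs z))). split; [now repeat apply Rmin_glb_lt|].
  pose proof (Rmin_l eps (Rmin u (Rabs z))). pose proof (Rmin_r eps (Rmin u (Rabs z))).
  pose proof (Rmin_l u (Rabs z)). pose proof (Rmin_r u (Rabs z)).
  intros n [v c]. rewrite sol_diag_gpow, sol_monomial, sol_diag_op_unip.
  intros (small_x & small_y & small_z & small_u).
  assert (n = 0%Z) as ->.
  { apply (IZR_mul_small n u). rewrite (Rabs_pos_eq u); lra. }
  rewrite Rmult_0_l, exp_0, Rmult_1_l in small_y.
  assert (v = (0, 0)%Z) as -> by (apply discrete; lra).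
  assert (c = 0%Z) as ->; [|easy].
  apply (IZR_mul_small c z). unfold lform in small_z; cbn [fst snd] in small_z.
  eapply Rle_lt_trans; [|eapply Rlt_le_trans; [exact small_z|lra]].
  right. f_equal. field.
Qed.

Lemma sol_unip_cobounded (x y w : R) : exists e rx ry rw,
  sol_unip x y w = unip_monomial e ⋅ sol_unip rx ry rw /\
  Rabs rx <= Rabs x1 + Rabs x2 /\ Rabs ry <= Rabs y1 + Rabs y2 /\ Rabs rw <= Rabs z.
Proof.
  destruct (lform_cobounded x1 x2 y1 y2 x y d_neq0) as (v & rx_le & ry_le).
  set (X := lform x1 x2 v) in *. set (Y := lform y1 y2 v) in *.
  set (h := lform w1 w2 v + IZR (fst v) * IZR (snd v) * ((x1 * y2 - x2 * y1) / 2)).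
  destruct (IZR_mul_cobounded z (w - h - (X * (y - Y) - (x - X) * Y) / 2) z_neq0)
    as [c rw_le].
  exists (v, c), (x - X), (y - Y), (w - h - (X * (y - Y) - (x - X) * Y) / 2 - IZR c * z).
  split; [|easy]. rewrite sol_monomial, sol_unip_op. fold X Y h. f_equal; field.
Qed.

Lemma sol_lattice_cocompact : exists B, forall g : sol_grp, exists n e k,
  R4_bounded B k /\ g = gpow (sol_diag u) n ⋅ unip_monomial e ⋅ k.
Proof.
  set (bound_x := Rabs x1 + Rabs x2). set (bound_y := Rabs y1 + Rabs y2).
  exists (bound_x * exp u + bound_y + (Rabs z + bound_x * bound_y / 2) + u).
  intros [[[x y] w] s].
  destruct (IZR_mul_cobounded u s) as [n r_le]; [lra|].
  set (r := s - IZR n * u) in *.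
  destruct (sol_unip_cobounded (x * exp (- r)) (exp (- (IZR n * u)) * y)
    (w - x * exp (- r) * (exp (- (IZR n * u)) * y) / 2))
    as (e & rx & ry & rw & E & rx_le & ry_le & rw_le).
  exists n, e, (sol_unip rx ry rw ⋅ sol_diag r). split.
  - rewrite sol_unip_op_diag. fold bound_x bound_y in rx_le, ry_le.
    rewrite (Rabs_pos_eq u) in r_le by lra.
    assert (exp_le : exp r <= exp u).
    { assert (r <= u) as [r_lt| ->] by (pose proof (Rle_abs r); lra);
        [left; now apply exp_increasing|apply Rle_refl]. }
    pose proof (Rabs_pos rx). pose proof (Rabs_pos ry). pose proof (exp_pos r).
    pose proof (Rabs_pos z). assert (0 <= bound_x * exp u) by nra.
    assert (0 <= bound_x * bound_y) by nra.
    repeat split.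
    + rewrite Rabs_mult, (Rabs_pos_eq (exp r)) by lra.
      assert (Rabs rx * exp r <= bound_x * exp u) by (apply Rmult_le_compat; lra). lra.
    + lra.
    + assert (Rabs rx * Rabs ry <= bound_x * bound_y) by (apply Rmult_le_compat; lra).
      eapply Rle_trans; [apply Rabs_triang|].
      unfold Rdiv. rewrite !Rabs_mult, (Rabs_pos_eq (/ 2)) by lra. lra.
    + lra.
  - replace s with (IZR n * u + r) by (unfold r; ring).
    now rewrite sol_factorization, E, sol_diag_gpow, !gassoc.
Qed.

Lemma sol_lattice_embedding_of_normal_form {P : Grp} (t1 t2 t3 tau : P) (f : P -> sol_grp) :
  is_hom f -> (forall x, exists n e, x = gpow t3 n ⋅ monomial t1 t2 tau e) ->
  f t1 = sol_unip x1 y1 w1 -> f t2 = sol_unip x2 y2 w2 -> f t3 = sol_diag u ->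
  f tau = sol_unip 0 0 z -> sol_lattice_embedding P f.
Proof.
  intros f_hom normal_form f1 f2 f3 f_tau.
  assert (f_monomial : forall n e, f (gpow t3 n ⋅ monomial t1 t2 tau e) =
                                   gpow (sol_diag u) n ⋅ unip_monomial e)
    by (intros n e; now rewrite f_hom, (hom_gpow f), (hom_monomial f), f1, f2, f3, f_tau).
  assert (discrete : exists eps, 0 < eps /\ forall x, R4_small eps (f x) -> x = gid).
  { destruct sol_lattice_discrete as (eps & eps_pos & discrete).
    exists eps. split; [easy|]. intros x. destruct (normal_form x) as (n & e & ->).
    rewrite f_monomial. intros small. apply discrete in small. destruct small as [-> ->].
    now rewrite monomial_tau_gpow, !gpow_0, gid_l. }
  repeat apply conj; [|intros g h; rewrite f_hom; apply sol_mx_op|easy|].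
  - apply (hom_injective f f_hom). intros x Ex.
    destruct discrete as (eps & eps_pos & discrete). apply discrete. rewrite Ex.
    cbn. now rewrite Rabs_R0.
  - destruct sol_lattice_cocompact as [B cocompact]. exists B. intros g.
    destruct (cocompact g) as (n & e & k & k_bounded & ->).
    exists (gpow t3 n ⋅ monomial t1 t2 tau e), k. split; [easy|].
    rewrite f_monomial. apply sol_mx_op.
Qed.

End SolLattice.

Close Scope R_scope.

Lemma presented_sol_lattice {A : M2} (det_A : M2det A = 1) (tr_A : M2tr A > 2) {q m1 m2 : Z}
  {P : Grp} {t1 t2 t3 tau : P} : q <> 0 -> is_presented A q m1 m2 P t1 t2 t3 tau ->
  exists rho : P -> R4, sol_lattice_embedding P rho.
Proof.
  intros q_neq0 pres.
  destruct (presented_central_ext det_A pres) as (pi & ext & lifts).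
  destruct (sol_pres_rel_exists A q m1 m2 det_A tr_A q_neq0)
    as (u & x1 & x2 & y1 & y2 & w1 & w2 & z & u_pos & d_neq0 & z_neq0 & rel).
  destruct (proj1 (proj2 pres _ _ _ _ _ rel))
    as (rho & rho_hom & rho1 & rho2 & rho3 & rho_tau).
  exists rho.
  apply (sol_lattice_embedding_of_normal_form u x1 x2 y1 y2 w1 w2 z
           u_pos d_neq0 z_neq0 t1 t2 t3 tau); try easy.
  intros x. rewrite <- (gpow_1 tau). apply (ext_normal_form det_A ext lifts).
Qed.

Lemma presented_nilradical {A : M2} (det_A : M2det A = 1) (tr_A : M2tr A > 2) {q m1 m2 : Z}
  {P : Grp} {t1 t2 t3 tau : P} : is_presented A q m1 m2 P t1 t2 t3 tau ->
  is_nilradical (gen (fun x => x = t1 \/ x = t2 \/ x = tau)).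
Proof.
  intros pres. destruct (presented_central_ext det_A pres) as (pi & ext & lifts).
  rewrite <- (gpow_1 tau). now apply (ext_nilradical det_A ext lifts).
Qed.

Theorem theorem5p1 (S : M2)
  (hdet : m11 S * m22 S - m12 S * m21 S = 1)
  (htr : m11 S + m22 S > 2) :
  exists Phi : CExt S -> Z * (Z * Z),
    (* (1) Phi induces a bijection  {classes of central extensions} -> Z (+) Coker(S - I) *)
    (forall E1 E2 : CExt S,
        ext_equiv E1 E2 <->
        (fst (Phi E1) = fst (Phi E2) /\ coker_eq S (snd (Phi E1)) (snd (Phi E2)))) /\
    (forall (q : Z) (v : Z * Z), exists E : CExt S,
        fst (Phi E) = q /\ coker_eq S (snd (Phi E)) v) /\
    (* (2) for q <> 0 the corresponding extension is the presented group *)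
    (forall q m1 m2 : Z, q <> 0 ->
      (exists (P : Grp) (t1 t2 t3 tau : P), is_presented S q m1 m2 P t1 t2 t3 tau) /\
      (forall (P : Grp) (t1 t2 t3 tau : P), is_presented S q m1 m2 P t1 t2 t3 tau ->
        (exists (pi : P -> (Z * Z) * Z) (H : is_central_ext S P (gpow tau) pi),
            pi t1 = ((1, 0), 0) /\ pi t2 = ((0, 1), 0) /\ pi t3 = ((0, 0), 1) /\
            fst (Phi (mkCExt S P (gpow tau) pi H)) = q /\
            coker_eq S (snd (Phi (mkCExt S P (gpow tau) pi H))) (m1, m2)) /\
        solvable P /\
        is_nilradical (gen (fun x : P => x = t1 \/ x = t2 \/ x = tau)) /\
        exists rho : P -> R4, sol_lattice_embedding P rho)).
Proof.
  destruct (functional_choice _ (has_invariants_exists hdet)) as [Phi Phi_inv].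
  exists Phi. split; [|split].
  - intros E1 E2. exact (ext_equiv_iff_invariants hdet _ _ _ _ _ _ (Phi_inv E1) (Phi_inv E2)).
  - intros q v. exists (tGamma_ext hdet q v).
    apply (has_invariants_iff_coker_eq hdet _ _ _ _ _ (Phi_inv _)).
    apply has_invariants_tGamma_ext.
  - intros q m1 m2 q_neq0. split.
    + do 5 eexists. apply (tGamma_presented hdet).
    + intros P t1 t2 t3 tau pres.
      destruct (presented_central_ext hdet pres) as (pi & ext & lifts).
      split; [|split; [|split]].
      * exists pi, ext. destruct lifts as (pi1 & pi2 & pi3). repeat (split; [easy|]).
        apply (has_invariants_iff_coker_eq hdet _ _ _ _ _ (Phi_inv _)).
        exists t1, t2, t3. split; [easy|]. cbn [cx_iota cx_grp]. rewrite gpow_1. apply pres.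
      * exact (ext_solvable hdet ext).
      * exact (presented_nilradical hdet htr pres).
      * exact (presented_sol_lattice hdet htr q_neq0 pres).
Qed.
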